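(* Let $A,B\in\mathbb M(n)$ and $1\le k\le n$. Let $A=U|A|$ be a polar decomposition of $A$ ($U$ unitary, $|A|=(A^*A)^{1/2}$). If there exist $k$ orthonormal vectors $u_1,\dots,u_k\in\mathbb C^n$ such that $$|A|\,u_i=s_i(A)\,u_i\quad\text{for all }1\le i\le k$$ and $$\sum_{i=1}^k\langle u_i,U^*Bu_i\rangle=0,$$ then $A$ is Birkhoff–James orthogonal to $B$ in $\|\cdot\|_{(k)}$, i.e. $\|A+\lambda B\|_{(k)}\ge\|A\|_{(k)}$ for all $\lambda\in\mathbb C$. If $s_k(A)>0$, then the converse also holds: if $A$ is Birkhoff–James orthogonal to $B$ in $\|\cdot\|_{(k)}$, then such orthonormal vectors $u_1,\dots,u_k$ exist.
   Context: $\mathbb M(n)$ denotes the space of $n\times n$ complex matrices. For $A\in\mathbb M(n)$, $s_1(A)\ge s_2(A)\ge\dots\ge s_n(A)\ge0$ are its singular values, and the Ky Fan $k$-norm is $\|A\|_{(k)}=s_1(A)+\dots+s_k(A)$. Inner products on $\mathbb C^n$ are conjugate linear in the first argument and linear in the second. $A$ is (Birkhoff–James) orthogonal to $B$ in a norm $\|\cdot\|$ if $\|A+\lambda B\|\ge\|A\|$ for all $\lambda\in\mathbb C$. *)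

(* Defs.v *)
(* Complex numbers are modelled by an arbitrary
   numClosedFieldType C (algebraically closed field with conjugation and
   partial order, e.g. algC). *)
From HB Require Import structures.
From mathcomp Require Import all_boot all_order all_algebra.
Set Implicit Arguments. Unset Strict Implicit. Unset Printing Implicit Defensive.
Import Order.TTheory GRing.Theory Num.Theory.
Local Open Scope ring_scope.
Local Open Scope sesquilinear_scope.

Section Defs.
Variable C : numClosedFieldType.

Definition adjmx m n (M : 'M[C]_(m, n)) : 'M[C]_(n, m) := M ^t*.

Definition ip n (x y : 'cV[C]_n) : C := (adjmx x *m y) 0 0.

(* A list of the roots (with multiplicity) of the characteristic polynomial
   of A^* A, i.e. the eigenvalues of A^* A. *)
Definition eig_AstarA n (A : 'M[C]_n) : seq C :=
  sval (closed_field_poly_normal (char_poly (adjmx A *m A))).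

(* Singular values s_1(A) >= ... >= s_n(A): square roots of the eigenvalues
   of A^* A, sorted in nonincreasing order.  s_i(A) = (svals A)`_(i-1). *)
Definition svals n (A : 'M[C]_n) : seq C :=
  sort (fun x y : C => y <= x) [seq sqrtC r | r <- eig_AstarA A].

Definition kyfan (k : nat) n (A : 'M[C]_n) : C := \sum_(i < k) (svals A)`_i.

Definition bj_orth n (N : 'M[C]_n -> C) (A B : 'M[C]_n) : Prop :=
  forall lambda : C, N A <= N (A + lambda *: B).

Definition psdmx n (P : 'M[C]_n) : Prop :=
  adjmx P = P /\ forall x : 'cV[C]_n, 0 <= ip x (P *m x).

Definition orthonormal_fam k n (u : 'I_k -> 'cV[C]_n) : Prop :=
  forall i j : 'I_k, ip (u i) (u j) = (i == j)%:R.

End Defs.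

(* Main.v *)
Require Import Defs.
From HB Require Import structures.
From mathcomp Require Import all_boot all_order all_algebra.
From mathcomp Require Import perm ring.
Import Order.TTheory GRing.Theory Num.Theory.
Local Open Scope ring_scope.

(* If u_1, ..., u_k is a frame as in the statement, the dual description of the
   Ky Fan norm gives |sum <U u_i, (A + lambda B) u_i>| <= ||A + lambda B||_(k),
   and the left-hand side is ||A||_(k).

   For the converse, pass to X = U^* B and P = diag(sg).  Singular values of a
   matrix are eigenvalues of its hermitian dilation on C^n + C^n, and a sum of the
   k largest eigenvalues of a hermitian matrix is the largest value, on unit
   k-particle vectors, of its second quantization on the fermionic Fock space.
   There the planar alternative for numerical ranges applies: either some vector
   maximising the form of P kills the form of X, or some lambda makes
   ||P + lambda X||_(k) < ||P||_(k).  In the first case the one-particle density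
   matrix D of the vector satisfies 0 <= D <= 1, tr D = k and tr (X D) = 0, commutes
   with P, and has fractional weights only on the eigenspace of s_k(A); since
   numerical ranges are convex, these weights can be moved to 0 or 1 two at a time,
   which turns D into the projection onto the required frame.

   C is an arbitrary numClosedFieldType, whose real elements need not be complete,
   so compactness is not available: extremal points are produced by roots of
   characteristic polynomials instead. *)
Set Implicit Arguments.
Unset Strict Implicit.
Unset Printing Implicit Defensive.

Local Open Scope sesquilinear_scope.

Section InnerProduct.
Variable C : numClosedFieldType.

Lemma adjmxE m n (M : 'M[C]_(m, n)) i j : adjmx M i j = (M j i)^*.
Proof. by rewrite !mxE. Qed.

Lemma adjmxK m n (M : 'M[C]_(m, n)) : adjmx (adjmx M) = M.
Proof. by apply/matrixP=> i j; rewrite !adjmxE conjCK. Qed.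

Lemma adjmxM m n p (M : 'M[C]_(m, n)) (N : 'M[C]_(n, p)) :
  adjmx (M *m N) = adjmx N *m adjmx M.
Proof.
apply/matrixP=> i j; rewrite adjmxE !mxE rmorph_sum; apply: eq_bigr => l _.
by rewrite !adjmxE rmorphM mulrC.
Qed.

Lemma adjmxD m n (M N : 'M[C]_(m, n)) : adjmx (M + N) = adjmx M + adjmx N.
Proof. by apply/matrixP=> i j; rewrite !(adjmxE, mxE) rmorphD. Qed.

Lemma adjmxB m n (M N : 'M[C]_(m, n)) : adjmx (M - N) = adjmx M - adjmx N.
Proof. by apply/matrixP=> i j; rewrite !(adjmxE, mxE) rmorphB. Qed.

Lemma adjmxZ m n a (M : 'M[C]_(m, n)) : adjmx (a *: M) = a^* *: adjmx M.
Proof. by apply/matrixP=> i j; rewrite !(adjmxE, mxE) rmorphM. Qed.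

Lemma adjmx0 m n : adjmx (0 : 'M[C]_(m, n)) = 0.
Proof. by apply/matrixP=> i j; rewrite !(adjmxE, mxE) rmorph0. Qed.

Lemma adjmx_scalar n (a : C) : adjmx (a%:M : 'M[C]_n) = a^*%:M.
Proof.
by apply/matrixP=> i j; rewrite !(adjmxE, mxE) eq_sym; case: (i == j); rewrite ?rmorph0.
Qed.

Lemma adjmx_sum (I : Type) (r : seq I) (Q : pred I) m n (F : I -> 'M[C]_(m, n)) :
  adjmx (\sum_(i <- r | Q i) F i) = \sum_(i <- r | Q i) adjmx (F i).
Proof. by apply: (big_morph _ (@adjmxD m n) (adjmx0 m n)). Qed.

Lemma adjmx_diag n (d : 'rV[C]_n) : (forall i, d 0 i \is Num.real) ->
  adjmx (diag_mx d) = diag_mx d.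
Proof.
move=> rd; apply/matrixP=> i j; rewrite !(adjmxE, mxE) eq_sym.
by case: eqVneq => [->|_]; rewrite ?mulr0n ?rmorph0 // !mulr1n (CrealP (rd j)).
Qed.

Lemma unitary_adjmx n (U : 'M[C]_n) : U \is unitarymx -> adjmx U *m U = 1%:M.
Proof.
move=> uU; have uUt : U^t* \is unitarymx by rewrite trmxC_unitary.
by rewrite -[RHS](unitarymxP uUt) trmxCK.
Qed.

Lemma unitary_mulmx_adj n (U : 'M[C]_n) : U \is unitarymx -> U *m adjmx U = 1%:M.
Proof. by move/unitarymxP. Qed.

Lemma unitary_of_adjmx n (U : 'M[C]_n) : adjmx U *m U = 1%:M -> U \is unitarymx.
Proof. by move/mulmx1C/unitarymxP. Qed.

Lemma ipE n (x y : 'cV[C]_n) : ip x y = \sum_i (x i 0)^* * y i 0.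
Proof. by rewrite /ip mxE; apply: eq_bigr => i _; rewrite adjmxE. Qed.

Lemma ip_adj m n (M : 'M[C]_(m, n)) x y : ip x (M *m y) = ip (adjmx M *m x) y.
Proof. by rewrite /ip adjmxM adjmxK mulmxA. Qed.

Lemma ip_mul m n (M : 'M[C]_(m, n)) x y : ip (M *m x) y = ip x (adjmx M *m y).
Proof. by rewrite ip_adj adjmxK. Qed.

Lemma ip_conj n (x y : 'cV[C]_n) : (ip x y)^* = ip y x.
Proof.
rewrite !ipE rmorph_sum; apply: eq_bigr => i _.
by rewrite rmorphM /= conjCK mulrC.
Qed.

Lemma ipDr n (x y z : 'cV[C]_n) : ip x (y + z) = ip x y + ip x z.
Proof. by rewrite /ip mulmxDr mxE. Qed.

Lemma ipDl n (x y z : 'cV[C]_n) : ip (x + y) z = ip x z + ip y z.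
Proof. by rewrite /ip adjmxD mulmxDl mxE. Qed.

Lemma ipZr n a (x y : 'cV[C]_n) : ip x (a *: y) = a * ip x y.
Proof. by rewrite /ip -scalemxAr mxE. Qed.

Lemma ipZl n a (x y : 'cV[C]_n) : ip (a *: x) y = a^* * ip x y.
Proof. by rewrite /ip adjmxZ -scalemxAl mxE. Qed.

Lemma ip0r n (x : 'cV[C]_n) : ip x 0 = 0.
Proof. by rewrite /ip mulmx0 mxE. Qed.

Lemma ip0l n (x : 'cV[C]_n) : ip 0 x = 0.
Proof. by rewrite /ip adjmx0 mul0mx mxE. Qed.

Lemma ipNr n (x y : 'cV[C]_n) : ip x (- y) = - ip x y.
Proof. by rewrite -scaleN1r ipZr mulN1r. Qed.

Lemma ipNl n (x y : 'cV[C]_n) : ip (- x) y = - ip x y.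
Proof. by rewrite -ip_conj ipNr rmorphN /= ip_conj. Qed.

Lemma ipBr n (x y z : 'cV[C]_n) : ip x (y - z) = ip x y - ip x z.
Proof. by rewrite ipDr ipNr. Qed.

Lemma ip_sumr (I : Type) (r : seq I) (Q : pred I) n x (F : I -> 'cV[C]_n) :
  ip x (\sum_(i <- r | Q i) F i) = \sum_(i <- r | Q i) ip x (F i).
Proof. by apply: (big_morph _ (@ipDr n x) (ip0r x)). Qed.

Lemma ip_suml (I : Type) (r : seq I) (Q : pred I) n x (F : I -> 'cV[C]_n) :
  ip (\sum_(i <- r | Q i) F i) x = \sum_(i <- r | Q i) ip (F i) x.
Proof. by apply: (big_morph (fun y => ip y x) (fun y z => ipDl y z x) (ip0l x)). Qed.

Lemma ip_ge0 n (x : 'cV[C]_n) : 0 <= ip x x.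
Proof. by rewrite ipE sumr_ge0 // => i _; rewrite mulrC mul_conjC_ge0. Qed.

Lemma ip_eq0 n (x : 'cV[C]_n) : (ip x x == 0) = (x == 0).
Proof.
apply/eqP/eqP=> [|->]; last by rewrite ip0r.
rewrite ipE => /eqP; rewrite psumr_eq0; last first.
  by move=> i _; rewrite mulrC mul_conjC_ge0.
move/allP=> x0; apply/matrixP=> i j; rewrite ord1 !mxE; apply/eqP.
by have := x0 i (mem_index_enum i); rewrite /= mulrC mul_conjC_eq0.
Qed.

Lemma ip_gt0 n (x : 'cV[C]_n) : (0 < ip x x) = (x != 0).
Proof. by rewrite lt0r ip_eq0 ip_ge0 andbT. Qed.

Lemma unitary_ip n (U : 'M[C]_n) x y :
  U \is unitarymx -> ip (U *m x) (U *m y) = ip x y.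
Proof. by move=> uU; rewrite ip_mul mulmxA unitary_adjmx // mul1mx. Qed.

Lemma ip_col m n p (M : 'M[C]_(m, n)) (N : 'M[C]_(m, p)) i j :
  ip (col i M) (col j N) = (adjmx M *m N) i j.
Proof. by rewrite ipE mxE; apply: eq_bigr => l _; rewrite adjmxE !mxE. Qed.

Lemma unitary_ip_col n (U : 'M[C]_n) i j :
  U \is unitarymx -> ip (col i U) (col j U) = (i == j)%:R.
Proof. by move=> uU; rewrite ip_col unitary_adjmx // mxE. Qed.

Lemma ip_delta n i (x : 'cV[C]_n) : ip (delta_mx i 0) x = x i 0.
Proof.
rewrite ipE (bigD1 i) //= big1 => [|j /negbTE ji]; rewrite !mxE ?ji /= ?rmorph0 ?mul0r //.
by rewrite !eqxx rmorph1 mul1r addr0.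
Qed.

End InnerProduct.

Section Planar.
Variable C : numClosedFieldType.
Implicit Types a b c z : C.

Lemma real_dependency3 a b c : exists x y z : C,
  [/\ x \is Num.real, y \is Num.real, z \is Num.real,
      ~~ [&& x == 0, y == 0 & z == 0] & x * a + y * b + z * c = 0].
Proof.
pose dt (u v : C) : C := 'i * (u^* * v - u * v^*).
have rdt u v : dt u v \is Num.real.
  apply/CrealP; rewrite /dt rmorphM rmorphB !rmorphM /= !conjCK conjCi; ring.
have [/and3P[_ _ z0]|N] := boolP [&& dt b c == 0, dt c a == 0 & dt a b == 0];
  last first.
  by exists (dt b c), (dt c a), (dt a b); split; rewrite ?rdt // /dt; ring.
have [a0|a0] := eqVneq a 0.
  exists 1, 0, 0; split; rewrite ?real1 ?real0 ?oner_eq0 //.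
  by rewrite a0 !mul0r mulr0 !addr0.
exists (- (a^* * b)), (a * a^*), 0; split; rewrite ?real0 //.
- apply/CrealP; rewrite rmorphN rmorphM /= conjCK.
  move: z0; rewrite mulf_eq0 (negbTE (neq0Ci C)) subr_eq0 => /eqP ->.
  by [].
- exact/ger0_real/mul_conjC_ge0.
- by rewrite mul_conjC_eq0 (negbTE a0) andbF.
- ring.
Qed.

Definition balanced n (d : 'I_n -> C) : Prop := exists p : 'I_n -> C,
  [/\ forall i, 0 <= p i, 0 < \sum_i p i & \sum_i p i * d i = 0].

Lemma balanced3 n (d : 'I_n -> C) i j l x y z :
    0 <= x -> 0 <= y -> 0 <= z -> 0 < x + y + z ->
    x * d i + y * d j + z * d l = 0 ->
  balanced d.
Proof.
move=> x0 y0 z0 s0 e0.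
pose dl (i j : 'I_n) : C := (i == j)%:R.
have sumdl (w : 'I_n -> C) j0 : \sum_i0 dl i0 j0 * w i0 = w j0.
  rewrite (bigD1 j0) //= big1 /dl ?eqxx ?mul1r ?addr0 // => t /negbTE ->.
  by rewrite mul0r.
pose p t := x * dl t i + y * dl t j + z * dl t l.
have sump (w : 'I_n -> C) : \sum_t p t * w t = x * w i + y * w j + z * w l.
  rewrite -(sumdl w i) -(sumdl w j) -(sumdl w l) !mulr_sumr -!big_split /=.
  by apply: eq_bigr => t _; rewrite /p; ring.
exists p; split; last by rewrite sump.
- by move=> t; rewrite !addr_ge0 // mulr_ge0 // ler0n.
- by have := sump (fun=> 1); under eq_bigr do rewrite mulr1; move=> ->; rewrite !mulr1.
Qed.

Lemma balanced_lift n (d : 'I_n.+1 -> C) : balanced (d \o lift ord0) -> balanced d.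
Proof.
case=> p [p0 ps pd]; exists (fun i => if unlift ord0 i is Some j then p j else 0).
split.
- by move=> i; case: unlift.
- by rewrite big_ord_recl unlift_none add0r; under eq_bigr do rewrite liftK.
- by rewrite big_ord_recl unlift_none mul0r add0r; under eq_bigr do rewrite liftK.
Qed.

Definition in_cone (u v w : C) : Prop :=
  exists x y : C, [/\ 0 <= x, 0 <= y & u = x * v + y * w].

Lemma balanced_or_cone n (d : 'I_n -> C) i j l x y z :
    x \is Num.real -> 0 <= y -> 0 <= z -> ~~ [&& x == 0, y == 0 & z == 0] ->
    x * d i + y * d j + z * d l = 0 ->
  balanced d \/ in_cone (d i) (d j) (d l).
Proof.
move=> xr y0 z0 nz e; have [x0|xn] := real_ge0P xr.
  left; apply: (balanced3 x0 y0 z0 _ e).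
  rewrite lt0r !addr_ge0 // !paddr_eq0 ?addr_ge0 // andbT.
  by apply: contra nz => /andP[/andP[-> ->] ->].
right; exists (y / - x), (z / - x); rewrite !divr_ge0 ?oppr_ge0 ?(ltW xn) //; split=> //.
have xu : x != 0 by rewrite ltr0_neq0.
have {}e : x * d i = - (y * d j + z * d l).
  by apply/eqP; rewrite -subr_eq0 opprK addrA e.
have -> : d i = (x * d i) / x by field.
by rewrite e; field.
Qed.

Lemma three_rays n (d : 'I_n -> C) i j l :
  [\/ balanced d, in_cone (d i) (d j) (d l), in_cone (d j) (d i) (d l) |
      in_cone (d l) (d i) (d j)].
Proof.
have [x [y [z [xr yr zr nz e]]]] := real_dependency3 (d i) (d j) (d l).
wlog xy : x y z xr yr zr nz e / (0 <= x) && (0 <= y) || (0 <= x) && (0 <= z)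
    || (0 <= y) && (0 <= z).
  move=> W; have [|] := boolP ((0 <= x) && (0 <= y) || (0 <= x) && (0 <= z)
    || (0 <= y) && (0 <= z)); first exact: W.
  move=> H; apply: (W (- x) (- y) (- z)); rewrite ?realN ?oppr_eq0 //.
    by rewrite !mulNr -!opprD e oppr0.
  rewrite !oppr_ge0; have neg (t : C) : t \is Num.real -> ~~ (0 <= t) -> t <= 0.
    by move=> tr nt; apply/ltW; rewrite real_ltNge ?real0.
  move: (neg x xr) (neg y yr) (neg z zr) H.
  by case: (0 <= x); case: (0 <= y); case: (0 <= z); move=> // h1 h2 h3;
    rewrite ?(h1 isT) ?(h2 isT) ?(h3 isT) ?orbT.
case/orP: xy => [/orP[]|] /andP[h1 h2].
- have nz' : ~~ [&& z == 0, x == 0 & y == 0].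
    by apply: contra nz => /and3P[-> -> ->].
  have e' : z * d l + x * d i + y * d j = 0 by rewrite -e; ring.
  have [] := balanced_or_cone zr h1 h2 nz' e'; first by constructor 1.
  by constructor 4.
- have nz' : ~~ [&& y == 0, x == 0 & z == 0].
    by apply: contra nz => /and3P[-> -> ->].
  have e' : y * d j + x * d i + z * d l = 0 by rewrite -e; ring.
  have [] := balanced_or_cone yr h1 h2 nz' e'; first by constructor 1.
  by constructor 3.
- have [] := balanced_or_cone xr h1 h2 nz e; first by constructor 1.
  by constructor 2.
Qed.

Lemma in_cone_id1 u v : in_cone u u v.
Proof. by exists 1, 0; split=> //; ring. Qed.

Lemma in_coneC u v w : in_cone u v w -> in_cone u w v.
Proof. by move=> [x [y [x0 y0 ->]]]; exists y, x; split=> //; ring. Qed.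

Lemma in_cone_trans u v w t :
  in_cone u v w -> in_cone v t w -> in_cone u t w.
Proof.
move=> [x [y [x0 y0 ->]]] [x' [y' [x0' y0' ->]]].
by exists (x * x'), (x * y' + y); rewrite ?(mulr_ge0, addr_ge0) //; split=> //; ring.
Qed.

Lemma extremal_rays n (d : 'I_n.+1 -> C) :
  balanced d \/ exists i j, forall l, in_cone (d l) (d i) (d j).
Proof.
elim: n d => [|n IHn] d.
  right; exists ord0, ord0 => l; rewrite ord1; exact: in_cone_id1.
have [/balanced_lift|[i [j dij]]] := IHn (d \o lift ord0); first by left.
set i1 := lift ord0 i; set j1 := lift ord0 j.
have [|h|h|h] := three_rays d i1 j1 ord0; first by left.
- right; exists j1, ord0 => l; case: (unliftP ord0 l) => [t|] ->.
    apply/in_coneC/(in_cone_trans _ (in_coneC h))/(dij t).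
  exact/in_coneC/in_cone_id1.
- right; exists i1, ord0 => l; case: (unliftP ord0 l) => [t|] ->.
    by apply/in_coneC/(in_cone_trans _ (in_coneC h))/in_coneC/(dij t).
  exact/in_coneC/in_cone_id1.
- by right; exists i1, j1 => l; case: (unliftP ord0 l) => [t|] -> //; apply: dij.
Qed.

Lemma gordan n (d : 'I_n -> C) :
  balanced d \/ exists theta, forall i, 0 < theta * d i + (theta * d i)^*.
Proof.
case: n d => [|n] d; first by right; exists 1; case.
have [|[i [j dij]]] := extremal_rays d; first by left.
have [[l /eqP dl0]|dne0] := altP (@existsP _ (fun l => d l == 0)).
  left; apply: (@balanced3 _ d l l l 1 0 0); rewrite ?addr0 ?ltr01 ?ler01 //.
  by rewrite dl0; ring.
have {}dne0 l : d l != 0 by move: dne0; rewrite negb_exists => /forallP.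
have ni : 0 < `|d i| by rewrite normr_gt0.
have nj : 0 < `|d j| by rewrite normr_gt0.
set u := d i / `|d i|; set v := d j / `|d j|.
have [uv|uv] := eqVneq (u + v) 0.
  left; apply: (@balanced3 _ d i j j `|d i|^-1 `|d j|^-1 0);
    rewrite ?invr_ge0 ?normr_ge0 ?addr0 ?addr_gt0 ?invr_gt0 //.
  by transitivity (u + v) => //; rewrite /u /v; ring.
have unit_dir l : (d l / `|d l|) * (d l / `|d l|)^* = 1.
  by rewrite -normCK normf_div normr_id divff ?expr1n // normr_eq0.
have du : d i = `|d i| * u by rewrite /u; field; rewrite gt_eqF.
have dv : d j = `|d j| * v by rewrite /v; field; rewrite gt_eqF.
right; exists (u + v)^* => l; have [x [y [x0 y0 dl]]] := dij l.
have -> : (u + v)^* * d l + ((u + v)^* * d l)^* =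
    (x * `|d i| + y * `|d j|) * ((u + v) * (u + v)^*).
  have uu : u * u^* = 1 := unit_dir i; have vv : v * v^* = 1 := unit_dir j.
  have xr := CrealP (ger0_real x0); have yr := CrealP (ger0_real y0).
  have pr : `|d i|^* = `|d i| by rewrite conj_normC.
  have qr : `|d j|^* = `|d j| by rewrite conj_normC.
  have {}dl : d l = x * (`|d i| * u) + y * (`|d j| * v) by rewrite -du -dv.
  clear uv du dv.
  move: `|d i| `|d j| u v uu vv pr qr dl => p q u' v' uu vv pr qr ->.
  rewrite !(rmorphM, rmorphD) /= !conjCK pr qr xr yr.
  apply/eqP; rewrite -subr_eq0; apply/eqP.
  transitivity ((x * p - y * q) * (u' * u'^* - v' * v'^*)); first by ring.
  by rewrite uu vv subrr mulr0.
rewrite mulr_gt0 ?mul_conjC_gt0 // lt0r addr_ge0 ?mulr_ge0 ?normr_ge0 // andbT.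
rewrite paddr_eq0 ?mulr_ge0 ?normr_ge0 // !mulf_eq0 !normr_eq0.
rewrite !(negbTE (dne0 _)) !orbF; apply: contra (dne0 l) => /andP[/eqP x_0 /eqP y_0].
by rewrite dl x_0 y_0 !mul0r addr0.
Qed.
End Planar.

Section NumericalRange.
Variable C : numClosedFieldType.

Lemma unitmx_col0 m (v : 'cV[C]_m.+1) : v != 0 ->
  exists2 T : 'M[C]_m.+1, T \in unitmx & col 0 T = v.
Proof.
move=> v0; have vT0 : v^T != 0 by rewrite -trmx0 (inj_eq trmx_inj).
pose f : 'M[C]_m.+1 := delta_mx 0 0 *m v^T.
have e : (delta_mx 0 0 : 'rV[C]_m.+1) *m f = v^T.
  rewrite mulmxA mul_delta_mx; suff -> : delta_mx 0 0 = 1%:M :> 'M[C]_1 by rewrite mul1mx.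
  by apply/matrixP=> i j; rewrite !ord1 !mxE !eqxx.
have [|g gu ge] := @complete_unitmx _ _ _ (delta_mx 0 0 : 'rV[C]_m.+1) f.
  by rewrite e mxrank_delta rank_rV vT0.
exists g^T; rewrite ?unitmx_tr //.
by rewrite -tr_row rowE -ge e trmxK.
Qed.

Lemma unit_mulmx_neq0 m (T : 'M[C]_m) (v : 'cV[C]_m) :
  T \in unitmx -> v != 0 -> T *m v != 0.
Proof.
move=> Tu; apply: contra => /eqP/(congr1 (mulmx (invmx T))).
by rewrite mulKmx // mulmx0 => ->.
Qed.

Definition isotropic m (Y : 'M[C]_m) : Prop :=
  exists2 v : 'cV[C]_m, v != 0 & ip v (Y *m v) = 0.

Lemma isotropic_congr m (Y T : 'M[C]_m) : T \in unitmx ->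
  isotropic (adjmx T *m Y *m T) -> isotropic Y.
Proof.
move=> Tu [v v0 e]; exists (T *m v); first exact: unit_mulmx_neq0.
by rewrite ip_mul !mulmxA.
Qed.

Lemma unit_eigenvector m (Y : 'M[C]_m.+1) : isotropic Y \/
  exists (v : 'cV[C]_m.+1) mu, v != 0 /\ adjmx Y *m v = mu *: (Y *m v).
Proof.
have [Yu|Yn] := boolP (Y \in unitmx); last first.
  left; have : kermx Y^T != 0 by rewrite kermx_eq0 row_free_unit unitmx_tr.
  case/rowV0Pn => w /sub_kermxP wY w0.
  exists w^T; first by rewrite -trmx0 (inj_eq trmx_inj).
  by rewrite -[Y]trmxK -trmx_mul wY trmx0 ip0r.
have [mu /eigenvalueP[w ew w0]] := eigenvalue_closed (adjmx Y *m invmx Y)^T (ltn0Sn m).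
set x := w^T.
have x0 : x != 0 by rewrite -trmx0 (inj_eq trmx_inj).
have ex : adjmx Y *m invmx Y *m x = mu *: x.
  by rewrite -[_ *m x]trmxK trmx_mul trmxK ew linearZ.
right; exists (invmx Y *m x), mu.
by rewrite mulKVmx // -ex mulmxA unit_mulmx_neq0 ?unitmx_inv.
Qed.

Lemma adjmx_block m1 m2 n1 n2 (A : 'M[C]_(m1, n1)) (B : 'M[C]_(m1, n2))
    (D : 'M[C]_(m2, n1)) (E : 'M[C]_(m2, n2)) :
  adjmx (block_mx A B D E) = block_mx (adjmx A) (adjmx D) (adjmx B) (adjmx E).
Proof. by rewrite /adjmx tr_block_mx map_block_mx. Qed.

Lemma split_congr m (Y : 'M[C]_(1 + m)) : isotropic Y \/
  exists (T : 'M[C]_(1 + m)) (d : C) (Z : 'M[C]_m),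
    T \in unitmx /\ adjmx T *m Y *m T = block_mx d%:M 0 0 Z.
Proof.
have [|[v [mu [v0 ev]]]] := @unit_eigenvector m Y; first by left.
have [y0|y0] := eqVneq (ip v (Y *m v)) 0; first by left; exists v.
have [T Tu Tv] := unitmx_col0 v0.
right; set y := ip v (Y *m v) in y0.
have Te : T *m (delta_mx 0 0 : 'cV_(1 + m)) = v by rewrite -colE.
pose X : 'M[C]_(1 + m) := adjmx T *m Y *m T.
have eX : adjmx X *m (delta_mx 0 0 : 'cV_(1 + m)) = mu *: (X *m delta_mx 0 0).
  by rewrite /X !adjmxM adjmxK -!mulmxA Te ev -!scalemxAr.
have X00 : X 0 0 = y.
  have e00 (W : 'M[C]_(1 + m)) : W 0 0 = ip (delta_mx 0 0 : 'cV_(1 + m)) (W *m delta_mx 0 0).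
    by rewrite ip_delta -colE mxE.
  by rewrite e00 /X -!mulmxA Te ip_adj adjmxK Te.
have e0E : delta_mx 0 0 = col_mx 1%:M 0 :> 'cV[C]_(1 + m).
  apply/matrixP=> i j; rewrite ord1 -[i]splitK; case: (split i) => l /=.
    by rewrite col_mxEu ord1 !mxE !eqxx.
  by rewrite col_mxEd !mxE.
have ul00 (W : 'M[C]_(1 + m)) : ulsubmx W = (W 0 0)%:M.
  apply/matrixP=> i j; rewrite !ord1 !mxE eqxx mulr1n.
  by congr (W _ _); apply/val_inj.
have ulX : ulsubmx X = y%:M by rewrite ul00 X00.
have [b [c [e eqX]]] : exists b c e, X = block_mx y%:M b c e.
  by exists (ursubmx X), (dlsubmx X), (drsubmx X); rewrite -ulX submxK.
move: eX; rewrite eqX adjmx_block e0E !mul_block_col !mulmx1 !mulmx0 !addr0 scale_col_mx.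
case/eq_col_mx; rewrite adjmx_scalar => /matrixP/(_ 0 0).
rewrite !mxE /= !mulr1n => yy bc.
pose g := - (y^-1 *: b); pose G : 'M[C]_(1 + m) := block_mx 1%:M g 0 1%:M.
have Gu : G \in unitmx by rewrite unitmxE det_ublock !det1 mulr1 unitr1.
have [Z eZ] : exists Z, adjmx G *m X *m G = block_mx y%:M 0 0 Z.
  rewrite /G eqX adjmx_block !mulmx_block !adjmx_scalar rmorph1 adjmx0.
  rewrite !(mul0mx, mulmx0, mul1mx, mulmx1, addr0, add0r).
  have -> : y%:M *m g + b = 0.
    by rewrite mul_scalar_mx /g scalerN scalerA divff // scale1r addNr.
  suff -> : adjmx g *m y%:M + c = 0 by rewrite mul0mx add0r; eexists.
  rewrite mul_mx_scalar /g -scaleN1r scalerA adjmxZ bc scalerA scalerA.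
  have my : mu * y = y^* by rewrite -yy.
  suff -> : y * ((-1 / y)^* * mu) = -1 by rewrite scaleN1r addNr.
  rewrite rmorphM rmorphN1 fmorphV /=.
  have -> : y * ((-1 / y^*) * mu) = - (mu * y / y^*) by ring.
  by rewrite my divff // conjC_eq0.
exists (T *m G), y, Z; rewrite unitmx_mul Tu Gu; split=> //.
by rewrite -eZ /X adjmxM !mulmxA.
Qed.

Lemma diag_congr m (Y : 'M[C]_m) : isotropic Y \/
  exists S (d : 'rV[C]_m), S \in unitmx /\ adjmx S *m Y *m S = diag_mx d.
Proof.
elim: m Y => [|m IHm]; last rewrite -[m.+1]/(1 + m)%N; move=> Y.
  by right; exists 1%:M, 0; rewrite unitmx1; split=> //; apply/matrixP; case.
have [|[T [d [Z [Tu eT]]]]] := @split_congr m Y; first by left.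
have [[v v0 vZ]|[S [e [Su eS]]]] := IHm Z.
  left; apply: (@isotropic_congr (1 + m) _ T Tu); exists (col_mx (0 : 'M_1) v : 'cV_(1 + m)).
    by rewrite col_mx_eq0 negb_and v0 orbT.
  rewrite eT mul_block_col !mulmx0 !mul0mx !add0r.
  by rewrite -vZ /ip /adjmx tr_col_mx map_row_mx mul_row_col mulmx0 add0r.
right; pose G : 'M[C]_(1 + m) := block_mx 1%:M 0 0 S.
exists (T *m G), (row_mx d%:M e); split.
  by rewrite unitmx_mul Tu unitmxE det_ublock det1 mul1r -unitmxE.
have -> : adjmx (T *m G) *m Y *m (T *m G) = adjmx G *m (adjmx T *m Y *m T) *m G.
  by rewrite adjmxM !mulmxA.
rewrite eT /G adjmx_block !mulmx_block !adjmx_scalar rmorph1 !adjmx0.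
rewrite !(mul0mx, mulmx0, mul1mx, mulmx1, addr0, add0r) eS diag_mx_row.
by congr block_mx; apply/matrixP=> i j; rewrite !ord1 !mxE !eqxx.
Qed.

Lemma numerical_range_alt m (Y : 'M[C]_m) : isotropic Y \/
  exists theta, forall v, v != 0 ->
    0 < theta * ip v (Y *m v) + (theta * ip v (Y *m v))^*.
Proof.
have [|[S [d [Su eS]]]] := diag_congr Y; first by left.
have ipS (w : 'cV[C]_m) : ip (S *m w) (Y *m (S *m w)) =
    \sum_i (w i 0)^* * w i 0 * d 0 i.
  rewrite ip_mul !mulmxA eS ipE; apply: eq_bigr => i _.
  by rewrite mul_diag_mx mxE; ring.
have [[p [p0 ps pd]]|[theta th]] := gordan (fun i => d 0 i).
  left; pose w : 'cV[C]_m := \col_i sqrtC (p i).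
  have wp i : (w i 0)^* * w i 0 = p i.
    by rewrite mxE -normCKC ger0_norm ?sqrtC_ge0 // sqrtCK.
  exists (S *m w).
    apply: unit_mulmx_neq0 => //; apply: contraTneq ps => w0.
    by rewrite big1 ?ltxx // => i _; rewrite -wp w0 mxE mulr0.
  by rewrite ipS -[RHS]pd; apply: eq_bigr => i _; rewrite wp.
right; exists theta => v v0; set w := invmx S *m v.
have w0 : w != 0 by rewrite unit_mulmx_neq0 ?unitmx_inv.
have -> : v = S *m w by rewrite mulKVmx.
rewrite ipS.
have -> : theta * (\sum_i (w i 0)^* * w i 0 * d 0 i) +
   (theta * (\sum_i (w i 0)^* * w i 0 * d 0 i))^* =
   \sum_i (w i 0)^* * w i 0 * (theta * d 0 i + (theta * d 0 i)^*).
  rewrite mulr_sumr rmorph_sum -big_split /=; apply: eq_bigr => i _.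
  by rewrite !rmorphM /= conjCK; ring.
have [i wi] := cV0Pn _ w0.
rewrite (bigD1 i) //= ltr_wpDr //.
  by apply: sumr_ge0 => j _; rewrite mulr_ge0 ?(ltW (th j)) // mulrC mul_conjC_ge0.
by rewrite mulr_gt0 // mulrC mul_conjC_gt0.
Qed.

Lemma psd_kernel m (L : 'M[C]_m) (v : 'cV[C]_m) :
  psdmx L -> ip v (L *m v) = 0 -> L *m v = 0.
Proof.
move=> [Lh L0] v0; apply/eqP; apply: contraTT isT => w0.
set w := L *m v in w0; set q := ip w w; set c := ip w (L *m w).
have q0 : 0 < q by rewrite /q ip_gt0.
have c0 : 0 <= c by exact: L0.
have c1 : 0 < c + 1 by rewrite ltr_wpDl.
pose t := - (q / (c + 1)).
have tr : t^* = t by apply/CrealP; rewrite realN rpred_div ?ger0_real ?(ltW q0) ?(ltW c1).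
have := L0 (v + t *: w); rewrite mulmxDr -scalemxAr !(ipDl, ipDr, ipZl, ipZr) tr v0.
have -> : ip v (L *m w) = q by rewrite ip_adj Lh.
rewrite -/w -/q -/c add0r.
have -> : t * q + (t * q + t * (t * c)) = - ((q / (c + 1)) ^+ 2 * (c + 2)).
  by rewrite /t; field; rewrite gt_eqF.
have pos : 0 < (q / (c + 1)) ^+ 2 * (c + 2).
  by rewrite mulr_gt0 ?exprn_gt0 ?divr_gt0 // ltr_wpDl // ltr0n.
by rewrite oppr_ge0 => /(lt_le_trans pos); rewrite ltxx.
Qed.

(* A hermitian form positive on ker L becomes positive everywhere after adding a
   multiple to L; the numerical range alternative for M + i L replaces the usual
   compactness argument. *)
Lemma finsler m (L K : 'M[C]_m) : psdmx L ->
  (exists v, [/\ v != 0, L *m v = 0 & ip v (K *m v) = 0]) \/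
  exists lam, forall v, v != 0 ->
    0 < ip v (L *m v) + (lam * ip v (K *m v) + (lam * ip v (K *m v))^*).
Proof.
move=> Lpsd; have [Lh L0] := Lpsd.
set E := (row_base (kermx L^T))^T.
have LE : L *m E = 0.
  apply: trmx_inj; rewrite trmx_mul trmxK trmx0; apply/sub_kermxP.
  by rewrite eq_row_base.
have E0 w : w != 0 -> E *m w != 0.
  rewrite -trmx_eq0 -(trmx_eq0 (E *m w)) trmx_mul trmxK => w0.
  by rewrite mulmx_free_eq0 // row_base_free.
have Esurj v : L *m v = 0 -> exists w, v = E *m w.
  move=> Lv; have /submxP[w ew] : (v^T <= row_base (kermx L^T))%MS.
    by rewrite eq_row_base; apply/sub_kermxP; rewrite -trmx_mul Lv trmx0.
  by exists w^T; apply: trmx_inj; rewrite trmx_mul !trmxK.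
have [[w w0]|[th hth]] := numerical_range_alt (adjmx E *m K *m E).
  rewrite -!mulmxA ip_adj adjmxK => e.
  by left; exists (E *m w); rewrite E0 // mulmxA LE mul0mx.
have {}hth (v : 'cV_m) : v != 0 -> L *m v = 0 -> 0 < th * ip v (K *m v) + (th * ip v (K *m v))^*.
  move=> v0 /Esurj[w ew]; have w0 : w != 0 by apply: contraNneq v0 => w0; rewrite ew w0 mulmx0.
  by have := hth w w0; rewrite -!mulmxA ip_adj adjmxK -ew.
right; pose M := th *: K + adjmx (th *: K).
have ipM v : ip v (M *m v) = th * ip v (K *m v) + (th * ip v (K *m v))^*.
  rewrite mulmxDl ipDr -scalemxAl ipZr; congr (_ + _).
  by rewrite ip_adj adjmxK -ip_conj -scalemxAl ipZr.
have Mr v : (ip v (M *m v))^* = ip v (M *m v) by rewrite ipM rmorphD /= conjCK addrC.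
have Lr v : (ip v (L *m v))^* = ip v (L *m v) by apply/CrealP/ger0_real/L0.
have Mreal (v : 'cV_m) : ip v (M *m v) \is Num.real by apply/CrealP.
have Lreal (v : 'cV_m) : ip v (L *m v) \is Num.real by apply/CrealP.
have ipY v : ip v ((M + 'i *: L) *m v) = ip v (M *m v) + 'i * ip v (L *m v).
  by rewrite mulmxDl ipDr -scalemxAl ipZr.
have [[v v0]|[t ht]] := numerical_range_alt (M + 'i *: L).
  rewrite ipY => e.
  have Mv0 : ip v (M *m v) = 0.
    have := Re_rect (Mreal v) (Lreal v).
    by rewrite e raddf0.
  have Lv0 : ip v (L *m v) = 0.
    have := Im_rect (Mreal v) (Lreal v).
    by rewrite e raddf0.
  have := hth v v0 (psd_kernel Lpsd Lv0).
  by rewrite -ipM Mv0 ltxx.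
pose a := t + t^*; pose b := 'i * (t - t^*).
have ar : a \is Num.real by apply/CrealP; rewrite rmorphD /= conjCK addrC.
have br : b \is Num.real by apply/CrealP; rewrite rmorphM rmorphB /= conjCK conjCi /b; ring.
have {}ht (v : 'cV_m) : v != 0 -> 0 < a * ip v (M *m v) + b * ip v (L *m v).
  move=> /ht; rewrite ipY rmorphM rmorphD /= rmorphM /= Mr Lr conjCi.
  by congr (0 < _); rewrite /a /b; ring.
have scal (r : C) v : r \is Num.real ->
    (r * th) * ip v (K *m v) + ((r * th) * ip v (K *m v))^* = r * ip v (M *m v).
  by move=> /CrealP rr; rewrite ipM -mulrA [(r * _)^*]rmorphM /= rr; ring.
have [b0|b0] := real_leP br (@real0 C).
  exists (a * th) => v /ht h; rewrite scal // ltr_wpDl ?L0 //.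
  apply: lt_le_trans h _; rewrite gerDl.
  by rewrite mulr_le0_ge0.
exists (a / b * th) => v /ht h; rewrite scal ?rpred_div //.
have -> : ip v (L *m v) + a / b * ip v (M *m v) =
   (a * ip v (M *m v) + b * ip v (L *m v)) / b by field; rewrite gt_eqF.
by rewrite divr_gt0.
Qed.
End NumericalRange.

Section Fermions.
Variable C : numClosedFieldType.

Definition car N m (a : 'I_N -> 'M[C]_m) : Prop :=
  (forall i j, a i *m a j + a j *m a i = 0) /\
  (forall i j, a i *m adjmx (a j) + adjmx (a j) *m a i = (i == j)%:R%:M).

(* The Jordan-Wigner construction. *)
Lemma car_exists N : exists m (a : 'I_N -> 'M[C]_m) (vac : 'cV[C]_m),
  [/\ car a, ip vac vac = 1 & forall i, a i *m vac = 0].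
Proof.
elim: N => [|N [m [a [vac [[aa aaT] vac1 avac]]]]].
  exists 1%N, (fun=> 0), 1%:M; split; first by split; case.
    by rewrite /ip adjmx_scalar rmorph1 mul1mx mxE eqxx.
  by case.
pose b (i : 'I_N.+1) : 'M[C]_(m + m) :=
  if unlift ord0 i is Some j then block_mx (a j) 0 0 (- a j)
  else block_mx 0 1%:M 0 0.
have b0 : b ord0 = block_mx 0 1%:M 0 0 by rewrite /b unlift_none.
have bS i : b (lift ord0 i) = block_mx (a i) 0 0 (- a i) by rewrite /b liftK.
have adjN (M : 'M[C]_m) : adjmx (- M) = - adjmx M.
  by rewrite -[- M]sub0r adjmxB adjmx0 sub0r.
have s0 : (0 : C)%:M = 0 :> 'M[C]_m by rewrite -scalemx1 scale0r.
exists (m + m)%N, b, (col_mx vac 0); split; last first.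
- move=> i; case: (unliftP ord0 i) => [j|] ->; rewrite ?b0 ?bS mul_block_col.
    by rewrite !(mul0mx, mulmx0, mul1mx, addr0, add0r) avac col_mx0.
  by rewrite !(mul0mx, mulmx0, mul1mx, addr0, add0r) col_mx0.
- rewrite /ip /adjmx tr_col_mx map_row_mx mul_row_col mulmx0 addr0; exact: vac1.
split=> i j; case: (unliftP ord0 i) => [i'|] ->; case: (unliftP ord0 j) => [j'|] ->;
  rewrite ?b0 ?bS ?adjmx_block ?adjmx_scalar ?adjmx0 ?conjC1 ?adjN
  !(mulmx_block, add_block_mx, mul0mx, mulmx0, mul1mx, mulmx1, addr0, add0r,
    mulmxN, mulNmx, opprK, oppr0).
- by rewrite aa block_mx_const.
- by rewrite ?addNr ?addrN block_mx_const.
- by rewrite ?addNr ?addrN block_mx_const.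
- by rewrite block_mx_const.
- by rewrite (inj_eq lift_inj) aaT scalar_mx_block.
- by rewrite ?addNr ?addrN lift_eqF raddf0 block_mx_const.
- by rewrite ?addNr ?addrN eq_liftF raddf0 block_mx_const.
- by rewrite scalar_mx_block.
Qed.

Section SecondQuantization.
Variables (N m : nat) (a : 'I_N -> 'M[C]_m).

Definition creation (f : 'cV[C]_N) : 'M[C]_m := \sum_i f i 0 *: adjmx (a i).

Definition dGamma (X : 'M[C]_N) : 'M[C]_m :=
  \sum_i \sum_j X i j *: (adjmx (a i) *m a j).

Lemma adjmx_creation f : adjmx (creation f) = \sum_i (f i 0)^* *: a i.
Proof. by rewrite adjmx_sum; apply: eq_bigr => i _; rewrite adjmxZ adjmxK. Qed.

Lemma dGamma_adj X : dGamma (adjmx X) = adjmx (dGamma X).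
Proof.
rewrite adjmx_sum /dGamma exchange_big; apply: eq_bigr => i _ /=.
rewrite adjmx_sum; apply: eq_bigr => j _.
by rewrite adjmxZ adjmxM adjmxK adjmxE.
Qed.

Lemma dGamma_diag d : dGamma (diag_mx d) = \sum_i d 0 i *: (adjmx (a i) *m a i).
Proof.
apply: eq_bigr => i _; rewrite (bigD1 i) //= big1 ?addr0 => [|j /negbTE ji].
  by rewrite mxE eqxx mulr1n.
by rewrite mxE eq_sym ji mulr0n scale0r.
Qed.

Hypothesis cara : car a.

Lemma a_creation i f : a i *m creation f = (f i 0)%:M - creation f *m a i.
Proof.
rewrite mulmx_sumr mulmx_suml -[(f i 0)%:M](subr0).
have -> : (f i 0)%:M - 0 = \sum_j (f j 0 *: ((i == j)%:R%:M : 'M[C]_m)).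
  rewrite subr0 (bigD1 i) //= big1 ?addr0 => [|j /negbTE ij].
    by rewrite eqxx scalemx1.
  by rewrite eq_sym ij raddf0 scaler0.
rewrite -sumrB; apply: eq_bigr => j _.
by rewrite -scalemxAr -scalemxAl -scalerBr -(cara.2 i j) addrK.
Qed.

Lemma adj_a_creation i f : adjmx (a i) *m creation f = - (creation f *m adjmx (a i)).
Proof.
rewrite mulmx_sumr mulmx_suml -sumrN; apply: eq_bigr => j _.
rewrite -scalemxAr -scalemxAl -scalerN; congr (_ *: _); apply/eqP.
by rewrite -addr_eq0 -!adjmxM -adjmxD cara.1 adjmx0.
Qed.

Lemma annihilation_creation g f :
  adjmx (creation g) *m creation f = (ip g f)%:M - creation f *m adjmx (creation g).
Proof.
rewrite adjmx_creation [LHS]mulmx_suml (mulmx_sumr (creation f)) ipE.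
rewrite (raddf_sum scalar_mx) -sumrB; apply: eq_bigr => i _.
rewrite -scalemxAl -scalemxAr a_creation scalerBr; congr (_ - _).
by rewrite scale_scalar_mx.
Qed.

Lemma dGamma_creation X f :
  dGamma X *m creation f = creation f *m dGamma X + creation (X *m f).
Proof.
have -> : creation (X *m f) = \sum_i \sum_j (X i j * f j 0) *: adjmx (a i).
  by apply: eq_bigr => i _; rewrite mxE scaler_suml.
rewrite mulmx_suml mulmx_sumr -big_split; apply: eq_bigr => i _ /=.
rewrite mulmx_suml mulmx_sumr -big_split; apply: eq_bigr => j _ /=.
rewrite -scalemxAl -scalemxAr.
have -> : adjmx (a i) *m a j *m creation f =
    f j 0 *: adjmx (a i) + creation f *m (adjmx (a i) *m a j).
  rewrite -mulmxA a_creation mulmxBr mul_mx_scalar; congr (_ + _).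
  by rewrite !mulmxA adj_a_creation mulNmx opprK.
by rewrite scalerDr scalerA addrC.
Qed.

Lemma creation_ip f g w w' : ip (creation f *m w) (creation g *m w') =
  ip f g * ip w w' - ip (adjmx (creation g) *m w) (adjmx (creation f) *m w').
Proof.
rewrite ip_mul mulmxA annihilation_creation mulmxBl ipBr mul_scalar_mx ipZr.
by congr (_ - _); rewrite -mulmxA; apply: ip_adj.
Qed.

Lemma slater_state (vac : 'cV[C]_m) k (f : nat -> 'cV[C]_N) :
    ip vac vac = 1 -> (forall i, a i *m vac = 0) ->
    (forall i j, (i < k)%N -> (j < k)%N -> ip (f i) (f j) = (i == j)%:R) ->
  exists v, [/\ ip v v = 1, dGamma 1%:M *m v = k%:R *: v,
    forall g, (forall i, (i < k)%N -> ip (f i) g = 0) -> adjmx (creation g) *m v = 0 &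
    forall X, ip v (dGamma X *m v) = \sum_(i < k) ip (f i) (X *m f i)].
Proof.
move=> vac1 avac; have dvac X : dGamma X *m vac = 0.
  rewrite mulmx_suml big1 // => i _; rewrite mulmx_suml big1 // => j _.
  by rewrite -scalemxAl -mulmxA avac mulmx0 scaler0.
elim: k => [|k IHk] fo.
  exists vac; split=> //; rewrite ?scale0r //.
    move=> g _; rewrite adjmx_creation mulmx_suml big1 // => i _.
    by rewrite -scalemxAl avac scaler0.
  by move=> X; rewrite big_ord0 dvac ip0r.
have [|v [v1 Nv gv Xv]] := IHk; first by move=> i j ik jk; rewrite fo // ltnW.
have fv : adjmx (creation (f k)) *m v = 0.
  by apply: gv => i ik; rewrite fo ?ltnS ?(ltnW ik) // (ltn_eqF ik).
exists (creation (f k) *m v); split.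
- by rewrite creation_ip // fv ip0r subr0 v1 mulr1 fo // eqxx.
- rewrite mulmxA dGamma_creation mul1mx mulmxDl -mulmxA Nv -scalemxAr.
  by rewrite -natr1 scalerDl scale1r.
- move=> g fg; rewrite mulmxA annihilation_creation mulmxBl mul_scalar_mx.
  rewrite -ip_conj fg // rmorph0 scale0r -mulmxA gv ?mulmx0 ?subr0 // => i ik.
  by rewrite fg // ltnW.
- move=> X; rewrite mulmxA dGamma_creation mulmxDl ipDr -mulmxA creation_ip //.
  rewrite creation_ip // !fv ip0l ip0r !subr0 v1 mulr1 fo // eqxx mul1r Xv.
  by rewrite big_ord_recr.
Qed.

Definition one_matrix (v : 'cV[C]_m) : 'M[C]_N :=
  \matrix_(i, j) ip (a j *m v) (a i *m v).

Lemma one_matrix_tr v X : \tr (X *m one_matrix v) = ip v (dGamma X *m v).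
Proof.
rewrite /mxtrace mulmx_suml ip_sumr; apply: eq_bigr => i _.
rewrite mxE mulmx_suml ip_sumr; apply: eq_bigr => j _.
by rewrite -scalemxAl ipZr -mulmxA [in RHS]ip_adj adjmxK mxE.
Qed.

Lemma one_matrix_form v x :
  ip x (one_matrix v *m x) = ip (adjmx (creation x) *m v) (adjmx (creation x) *m v).
Proof.
rewrite !adjmx_creation !mulmx_suml ip_suml ipE.
under eq_bigr do rewrite mxE mulr_sumr; rewrite exchange_big; apply: eq_bigr => j _.
rewrite ip_sumr; apply: eq_bigr => i _ /=.
by rewrite -!scalemxAl ipZl ipZr conjCK mxE; ring.
Qed.

Lemma one_matrix_form_compl v x :
  ip (creation x *m v) (creation x *m v) = ip v v * ip x x - ip x (one_matrix v *m x).
Proof.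
by rewrite creation_ip one_matrix_form mulrC.
Qed.

Lemma one_matrix_compl v i j :
  ip (adjmx (a i) *m v) (adjmx (a j) *m v) = (i == j)%:R * ip v v - one_matrix v i j.
Proof.
rewrite mxE ip_mul adjmxK mulmxA.
have -> : a i *m adjmx (a j) = (i == j)%:R%:M - adjmx (a j) *m a i.
  by rewrite -cara.2 addrK.
rewrite mulmxBl ipBr mul_scalar_mx ipZr; congr (_ - _).
by rewrite -mulmxA [in LHS]ip_adj adjmxK.
Qed.

End SecondQuantization.
End Fermions.

Section TopSum.
Variable C : numClosedFieldType.

Lemma normalize m (v : 'cV[C]_m) : v != 0 -> exists2 c, c != 0 & ip (c *: v) (c *: v) = 1.
Proof.
rewrite -ip_gt0 => q0; set q := ip v v in q0; exists (sqrtC q)^-1.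
  by rewrite invr_eq0 sqrtC_eq0 gt_eqF.
rewrite ipZl ipZr -/q mulrA -normCKC normfV ger0_norm ?sqrtC_ge0 ?(ltW q0) //.
by rewrite exprVn sqrtCK mulVf // gt_eqF.
Qed.

Definition density n k (D : 'M[C]_n) : Prop :=
  [/\ adjmx D = D, \tr D = k%:R & forall x, 0 <= ip x (D *m x) <= ip x x].

Lemma top_sum_alt N (h : 'I_N -> C) (T : {set 'I_N}) (s : C) (K : 'M[C]_N) :
    s \is Num.real -> (forall i, h i \is Num.real) ->
    (forall i, i \in T -> s <= h i) -> (forall i, i \notin T -> h i <= s) ->
  (exists D, [/\ density #|T| D, forall i j, h i < s -> D i j = 0,
     forall i j, s < h i -> D i j = (i == j)%:R & \tr (K *m D) = 0]) \/
  exists lam, forall f : nat -> 'cV[C]_N,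
    (forall i j, (i < #|T|)%N -> (j < #|T|)%N -> ip (f i) (f j) = (i == j)%:R) ->
    let S := lam * \sum_(i < #|T|) ip (f i) (K *m f i) in
    \sum_(i < #|T|) ip (f i) (diag_mx (\row_j h j) *m f i) + (S + S^*)
      < \sum_(i in T) h i.
Proof.
move=> sr hr hT hTn; set k := #|T|.
have [m [a [vac [cara vac1 avac]]]] := car_exists C N.
pose W := dGamma a 1%:M - k%:R%:M.
have Wh : adjmx W = W.
  by rewrite adjmxB -dGamma_adj !adjmx_scalar rmorph1 conjC_nat.
pose L := \sum_(i in T) (h i - s) *: (a i *m adjmx (a i)) +
  \sum_(i | i \notin T) (s - h i) *: (adjmx (a i) *m a i) + W *m W.
have ipL v : ip v (L *m v) =
    \sum_(i in T) (h i - s) * ip (adjmx (a i) *m v) (adjmx (a i) *m v) +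
    \sum_(i | i \notin T) (s - h i) * ip (a i *m v) (a i *m v) + ip (W *m v) (W *m v).
  rewrite /L 2!mulmxDl 2!mulmx_suml 2!ipDr 2!ip_sumr; congr (_ + _ + _).
  - by apply: eq_bigr => i _; rewrite -scalemxAl ipZr -mulmxA ip_adj.
  - by apply: eq_bigr => i _; rewrite -scalemxAl ipZr -mulmxA ip_adj adjmxK.
  - by rewrite -mulmxA [in LHS]ip_adj Wh.
have T0 v i : i \in T -> 0 <= (h i - s) * ip (adjmx (a i) *m v) (adjmx (a i) *m v).
  by move=> iT; rewrite mulr_ge0 ?ip_ge0 // subr_ge0 hT.
have Tn0 v i : i \notin T -> 0 <= (s - h i) * ip (a i *m v) (a i *m v).
  by move=> iT; rewrite mulr_ge0 ?ip_ge0 // subr_ge0 hTn.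
have Lpsd : psdmx L.
  split.
    rewrite /L !adjmxD !adjmx_sum adjmxM Wh; congr (_ + _ + _); apply: eq_bigr => i _;
      by rewrite adjmxZ adjmxM adjmxK rmorphB /= (CrealP sr) (CrealP (hr i)).
  by move=> v; rewrite ipL !addr_ge0 ?ip_ge0 // sumr_ge0 // => i; [exact: T0|exact: Tn0].
have [[v [v0 Lv Kv]]|[lam hlam]] := finsler (dGamma a K) Lpsd.
  left; have [c c0 v1] := normalize v0; set w := c *: v in v1.
  have Lw : L *m w = 0 by rewrite -scalemxAr Lv scaler0.
  have Kw : ip w (dGamma a K *m w) = 0.
    by rewrite -scalemxAr ipZl ipZr Kv !mulr0.
  have := ipL w; rewrite Lw ip0r => /esym/eqP.
  rewrite paddr_eq0 ?ip_ge0 ?addr_ge0 ?sumr_ge0 //; [|exact: T0|exact: Tn0].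
  rewrite paddr_eq0 ?sumr_ge0 //; [|exact: T0|exact: Tn0].
  rewrite !psumr_eq0; [|exact: Tn0|exact: T0].
  move=> /andP[/andP[/allP eT /allP eTn]]; rewrite ip_eq0 => /eqP Ww.
  have Nw : dGamma a 1%:M *m w = k%:R *: w.
    by apply/eqP; rewrite -subr_eq0 -mul_scalar_mx -mulmxBl Ww.
  exists (one_matrix a w); split; [split| | |].
  - by apply/matrixP=> i j; rewrite adjmxE !mxE ip_conj.
  - by rewrite -[one_matrix a w]mul1mx one_matrix_tr Nw ipZr v1 mulr1.
  - move=> x; rewrite one_matrix_form ip_ge0 /= -one_matrix_form -subr_ge0.
    by rewrite -[ip x x]mul1r -v1 -one_matrix_form_compl // ip_ge0.
  - move=> i j his; have iT : i \notin T by apply: contraTN his => /hT si; rewrite le_gtF.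
    have := eTn i (mem_index_enum i); rewrite iT mulf_eq0 ip_eq0 subr_eq0 gt_eqF //.
    by move=> /eqP e; rewrite mxE e ip0r.
  - move=> i j his; have iT : i \in T by apply: contraTT his => /hTn si; rewrite le_gtF.
    have := eT i (mem_index_enum i); rewrite iT mulf_eq0 ip_eq0 subr_eq0 gt_eqF //.
    move=> /eqP e; have := one_matrix_compl cara w i j.
    by rewrite e ip0l v1 mulr1 => /esym/eqP; rewrite subr_eq0 => /eqP.
  - by rewrite one_matrix_tr.
right; exists (- lam) => f fo /=; set S := - lam * _.
have [v [v1 Nv _ Xv]] := slater_state cara vac1 avac fo.
have v0 : v != 0 by rewrite -ip_gt0 v1.
have := hlam v v0; rewrite Xv ipL.
have -> : W *m v = 0 by rewrite mulmxBl Nv mul_scalar_mx subrr.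
rewrite ip0r addr0.
have aac i : ip (adjmx (a i) *m v) (adjmx (a i) *m v) = 1 - ip (a i *m v) (a i *m v).
  by rewrite one_matrix_compl // eqxx mul1r v1 mxE.
have Nsum : \sum_i ip (a i *m v) (a i *m v) = k%:R.
  have : \tr (1%:M *m one_matrix a v) = k%:R.
    by rewrite one_matrix_tr Nv ipZr v1 mulr1.
  by rewrite mul1mx => <-; apply: eq_bigr => i _; rewrite mxE.
rewrite -(Xv (diag_mx _)) dGamma_diag mulmx_suml ip_sumr.
have -> : \sum_i ip v ((\row_j h j) 0 i *: (adjmx (a i) *m a i) *m v) =
    \sum_i h i * ip (a i *m v) (a i *m v).
  by apply: eq_bigr => i _; rewrite mxE -scalemxAl ipZr -mulmxA ip_adj adjmxK.
have -> : \sum_(i in T) (h i - s) * ip (adjmx (a i) *m v) (adjmx (a i) *m v) +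
    \sum_(i | i \notin T) (s - h i) * ip (a i *m v) (a i *m v) =
    \sum_(i in T) h i - \sum_i h i * ip (a i *m v) (a i *m v).
  rewrite (bigID (mem T) predT) /=.
  have sT : \sum_(i in T) s = s * k%:R by rewrite sumr_const mulr_natr.
  have : \sum_(i in T) s - \sum_i s * ip (a i *m v) (a i *m v) = 0.
    by rewrite -mulr_sumr Nsum sT subrr.
  rewrite (bigID (mem T) predT) /= => /eqP; rewrite subr_eq0 => /eqP e.
  apply/eqP; rewrite -subr_eq0; apply/eqP.
  under eq_bigr do rewrite aac.
  rewrite (eq_bigr (fun i => h i - s - h i * ip (a i *m v) (a i *m v)
    + s * ip (a i *m v) (a i *m v))); last by move=> i _; ring.
  rewrite [X in _ + X - _](eq_bigr (fun i => s * ip (a i *m v) (a i *m v)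
    - h i * ip (a i *m v) (a i *m v))); last by move=> i _; ring.
  by rewrite !big_split /= !sumrN e; ring.
move=> pos; rewrite -subr_gt0; congr (0 < _): pos.
by rewrite /S !mulNr rmorphN /=; ring.
Qed.
End TopSum.

Section SingularValues.
Variable C : numClosedFieldType.

Definition eigenbasis n (M V : 'M[C]_n) (d : 'I_n -> C) : Prop :=
  V \is unitarymx /\ M *m V = V *m diag_mx (\row_i d i).

Lemma eigenbasisE n (M V : 'M[C]_n) d : eigenbasis M V d ->
  M = V *m diag_mx (\row_i d i) *m adjmx V.
Proof. by move=> [uV <-]; rewrite -mulmxA unitary_mulmx_adj // mulmx1. Qed.

Lemma eigenbasis_col n (M V : 'M[C]_n) d i : eigenbasis M V d ->
  M *m col i V = d i *: col i V.
Proof.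
move=> [_ e]; rewrite !colE mulmxA e -colE mul_mx_diag.
by apply/matrixP=> j l; rewrite -colE !mxE mulrC.
Qed.

Lemma eigenbasis_of_col n (M V : 'M[C]_n) d : V \is unitarymx ->
  (forall i, M *m col i V = d i *: col i V) -> eigenbasis M V d.
Proof.
move=> uV e; split=> //; apply/matrixP=> i j.
have /matrixP/(_ i 0) := e j; rewrite mul_mx_diag !mxE mulrC => <-.
by apply: eq_bigr => l _; rewrite mxE.
Qed.

Lemma normal_eigenbasis n (M : 'M[C]_n) : M *m adjmx M = adjmx M *m M ->
  exists V d, eigenbasis M V d.
Proof.
move=> /normalmxP/orthomx_spectralP e.
have uV := spectral_unitarymx M; set V := spectralmx M in e uV.
exists (adjmx V), (spectral_diag M 0); split; first by rewrite trmxC_unitary.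
rewrite {1}e invmx_unitary // -[_ *m V *m _]mulmxA unitary_mulmx_adj // mulmx1.
by congr (_ *m diag_mx _); apply/rowP=> i; rewrite mxE.
Qed.

Lemma eigenbasis_perm n (M V : 'M[C]_n) d (p : 'S_n) :
  eigenbasis M V d -> eigenbasis M (col_perm p V) (d \o p).
Proof.
move=> b; have [uV _] := b; apply: eigenbasis_of_col => [|i].
  apply: unitary_of_adjmx; apply/matrixP=> i j; rewrite -ip_col.
  have cp l : col l (col_perm p V) = col (p l) V by apply/matrixP=> ? ?; rewrite !mxE.
  by rewrite !cp unitary_ip_col // mxE (inj_eq perm_inj).
have -> : col i (col_perm p V) = col (p i) V by apply/matrixP=> ? ?; rewrite !mxE.
exact: eigenbasis_col.
Qed.

Lemma eigenvalue_form n (M V : 'M[C]_n) d i : eigenbasis M V d ->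
  d i = ip (col i V) (M *m col i V).
Proof.
by move=> b; rewrite (eigenbasis_col _ b) ipZr unitary_ip_col ?eqxx ?mulr1 //; case: b.
Qed.

Definition nonincreasing n (d : 'I_n -> C) : Prop :=
  forall i j : 'I_n, (i <= j)%N -> d j <= d i.

Lemma nneg_ge_total : {in Num.nneg &, total (fun x y : C => y <= x)}.
Proof. by move=> x y x0 y0; rewrite -[_ || _]/(_ >=< _) real_comparable // ger0_real. Qed.

Lemma ge_transC : transitive (fun x y : C => y <= x).
Proof. by move=> y x z h1 h2; apply: le_trans h2 h1. Qed.

Lemma sort_perm n (d : 'I_n -> C) : (forall i, 0 <= d i) ->
  exists p : 'S_n, nonincreasing (d \o p).
Proof.
move=> d0; set r := fun x y : C => y <= x; pose t := [tuple d i | i < n].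
have : perm_eq (sort r t) t by rewrite perm_sort.
move/tuple_permP => [p e]; exists p => i j ij.
have sr : sorted r (sort r t).
  apply: (sort_sorted_in nneg_ge_total); apply/allP=> _ /mapP[l _ ->]; exact: d0.
have nthE l : nth 0 (sort r t) (val l) = d (p l).
  by rewrite e -tnth_nth !tnth_mktuple.
have := sorted_leq_nth ge_transC (fun x => lexx x) 0 sr.
move=> /(_ (val i) (val j)); rewrite !inE !size_sort !size_tuple !ltn_ord.
by move=> /(_ isT isT ij); rewrite !nthE.
Qed.

Lemma psd_eigenbasis n (P : 'M[C]_n) : psdmx P ->
  exists V d, [/\ eigenbasis P V d, forall i, 0 <= d i & nonincreasing d].
Proof.
move=> [Ph P0]; have [|V [d b]] := @normal_eigenbasis _ P; first by rewrite Ph.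
have d0 i : 0 <= d i by rewrite (eigenvalue_form i b).
have [p dp] := sort_perm d0.
by exists (col_perm p V), (d \o p); split=> //=; apply: eigenbasis_perm.
Qed.

Lemma eigenbasis_char_poly n (M V : 'M[C]_n) d : eigenbasis M V d ->
  char_poly M = \prod_i ('X - (d i)%:P).
Proof.
move=> b; have [uV _] := b; rewrite (eigenbasisE b).
set D := diag_mx _.
have -> : char_poly (V *m D *m adjmx V) = char_poly D.
  have e1 : map_mx polyC V *m map_mx polyC (adjmx V) = 1%:M.
    by rewrite -map_mxM unitary_mulmx_adj // map_mx1.
  have eM : char_poly_mx (V *m D *m adjmx V) =
      map_mx polyC V *m char_poly_mx D *m map_mx polyC (adjmx V).
    rewrite /char_poly_mx mulmxBr mulmxBl !map_mxM; congr (_ - _).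
    by rewrite mul_mx_scalar -scalemxAl e1 scalemx1.
  rewrite /char_poly eM !det_mulmx mulrAC -det_mulmx e1 det1 mul1r //.
rewrite char_poly_trig ?diag_mx_is_trig //.
by apply: eq_bigr => i _; rewrite !mxE eqxx mulr1n.
Qed.

Lemma svalsE n (M V : 'M[C]_n) d : eigenbasis (adjmx M *m M) V (fun i => d i ^+ 2) ->
    (forall i, 0 <= d i) -> nonincreasing d ->
  svals M = [seq d i | i <- enum 'I_n].
Proof.
move=> b d0 dn; rewrite /svals.
have e : perm_eq (eig_AstarA M) [seq d i ^+ 2 | i <- enum 'I_n].
  rewrite /eig_AstarA; case: closed_field_poly_normal => r /= er.
  apply: prod_XsubC_eq; rewrite big_map big_enum -(eigenbasis_char_poly b) er.
  have /monicP -> : char_poly (adjmx M *m M) \is monic by exact: char_poly_monic.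
  by rewrite scale1r.
have e' : perm_eq [seq sqrtC x | x <- eig_AstarA M] [seq d i | i <- enum 'I_n].
  apply: perm_trans (perm_map sqrtC e) _; rewrite -map_comp.
  have ed : sqrtC \o (fun i => d i ^+ 2) =1 d by move=> i /=; rewrite sqrCK.
  by rewrite (eq_map ed).
have nn : all (mem Num.nneg) [seq d i | i <- enum 'I_n].
  by apply/allP=> _ /mapP[i _ ->]; apply: d0.
have nn' : {subset [seq sqrtC x | x <- eig_AstarA M] <= Num.nneg}.
  by move=> x; rewrite (perm_mem e'); apply/allP.
have /perm_sort_inP -> := e'.
- apply: sorted_sort; first exact: ge_transC.
  rewrite sorted_map; have : sorted ltn (map val (enum 'I_n)).
    by rewrite val_enum_ord iota_ltn_sorted.
  by rewrite sorted_map; apply: sub_sorted => i j /ltnW; apply: dn.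
- by move=> x y /nn' x0 /nn' y0; apply: nneg_ge_total.
- by move=> x y z _ _ _; apply: ge_transC.
- by move=> x y _ _ /= /andP[h1 h2]; apply/le_anti; rewrite h1 h2.
Qed.

Lemma nth_svals n (M V : 'M[C]_n) d (i : 'I_n) :
    eigenbasis (adjmx M *m M) V (fun i => d i ^+ 2) ->
    (forall i, 0 <= d i) -> nonincreasing d ->
  (svals M)`_i = d i.
Proof.
move=> b d0 dn; rewrite (svalsE b d0 dn) (nth_map i) ?size_enum_ord //.
by rewrite nth_ord_enum.
Qed.

Lemma orthonormal_extend n (f : 'I_n -> 'cV[C]_n) (S : {set 'I_n}) :
    {in S &, forall i j, ip (f i) (f j) = (i == j)%:R} ->
  exists2 g : 'I_n -> 'cV[C]_n, forall i j, ip (g i) (g j) = (i == j)%:R &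
    {in S, forall i, g i = f i}.
Proof.
have [r] := ubnP #|~: S|; elim: r f S => // r IHr f S leS fS.
have [S0|[i0]] := set_0Vmem (~: S).
  have inS i : i \in S by have := in_set0 i; rewrite -S0 inE => /negbFE.
  by exists f => // i j; apply: fS.
rewrite inE => i0S.
pose Q : 'M[C]_n := \matrix_(i, j) (if i \in S then (f i j 0)^* else 0).
have [w w0 Qw] : exists2 w : 'cV[C]_n, w != 0 & Q *m w = 0.
  have : kermx Q^T != 0.
    rewrite kermx_eq0 row_free_unit unitmx_tr.
    apply/negP => /mulmxV/matrixP/(_ i0 i0)/eqP.
    rewrite !mxE eqxx big1 1?eq_sym ?oner_eq0 // => j _.
    by rewrite mxE (negbTE i0S) mul0r.
  case/rowV0Pn => x /sub_kermxP xQ x0; exists x^T; first by rewrite trmx_eq0.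
  by apply: trmx_inj; rewrite trmx_mul trmxK xQ trmx0.
have {Qw} fw i : i \in S -> ip (f i) w = 0.
  move=> iS; transitivity ((Q *m w) i 0); last by rewrite Qw mxE.
  by rewrite ipE mxE; apply: eq_bigr => j _; rewrite mxE iS.
have [c _ cw] := normalize w0.
pose f' i := if i == i0 then c *: w else f i.
have f'S i : i \in S -> f' i = f i.
  by move=> iS; rewrite /f'; case: eqP => // ii; rewrite -ii iS in i0S.
have [||g go gf] := IHr f' (i0 |: S).
- rewrite -ltnS (leq_trans _ leS) // ltnS; apply: proper_card.
  apply/properP; split; first by rewrite setCS subsetUr.
  by exists i0; rewrite !inE ?eqxx.
- move=> i j; rewrite !inE => /predU1P[->|iS] /predU1P[->|jS].
  + by rewrite /f' eqxx cw.
  + rewrite (f'S j jS) /f' eqxx ipZl -ip_conj fw // conjC0 mulr0.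
    by case: eqP => // e; rewrite e jS in i0S.
  + rewrite (f'S i iS) /f' eqxx ipZr fw // mulr0.
    by case: eqP => // e; rewrite -e iS in i0S.
  + by rewrite !f'S // fS.
exists g => // i iS; rewrite gf ?f'S // !inE iS orbT //.
Qed.

Lemma svd n (M : 'M[C]_n) : exists (X Y : 'M[C]_n) (d : 'I_n -> C),
  [/\ X \is unitarymx, Y \is unitarymx, M *m Y = X *m diag_mx (\row_i d i),
      forall i : 'I_n, (svals M)`_i = d i & forall i, 0 <= d i] /\ nonincreasing d.
Proof.
have G0 : psdmx (adjmx M *m M).
  split; first by rewrite adjmxM adjmxK.
  by move=> x; rewrite -mulmxA -ip_mul ip_ge0.
have [Y [e [b e0 en]]] := psd_eigenbasis G0; have [uY _] := b.
pose d i := sqrtC (e i).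
have dd : (fun i => d i ^+ 2) =1 e by move=> i; rewrite sqrtCK.
have d0 i : 0 <= d i by rewrite sqrtC_ge0.
have dn : nonincreasing d by move=> i j /en; rewrite /d ler_sqrtC // nnegrE.
have b' : eigenbasis (adjmx M *m M) Y (fun i => d i ^+ 2).
  apply: eigenbasis_of_col => // i; rewrite dd; exact: eigenbasis_col.
pose f i := (d i)^-1 *: (M *m col i Y).
have ipf i j : ip (M *m col i Y) (M *m col j Y) = (i == j)%:R * d j ^+ 2.
  by rewrite ip_mul mulmxA (eigenbasis_col _ b') ipZr unitary_ip_col // mulrC.
have [|g go gf] := @orthonormal_extend n f [set i | d i != 0].
  move=> i j; rewrite !inE => di dj; rewrite ipZl ipZr ipf fmorphV /=.
  rewrite (CrealP (ger0_real (d0 i))).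
  by case: eqVneq => [->|_]; [field | rewrite !mul0r !mulr0].
pose X := \matrix_(i, j) g j i 0.
have cX i : col i X = g i by apply/matrixP=> ? ?; rewrite ord1 !mxE.
exists X, Y, d; split=> //; split=> //.
- apply: unitary_of_adjmx; apply/matrixP=> i j.
  by rewrite -ip_col !cX go mxE.
- apply/matrixP=> i j.
  have -> : (X *m diag_mx (\row_l d l)) i j = g j i 0 * d j.
    by rewrite mul_mx_diag !mxE.
  have -> : (M *m Y) i j = (M *m col j Y) i 0.
    by rewrite !mxE; apply: eq_bigr => l _; rewrite !mxE.
  have [dj|dj] := eqVneq (d j) 0.
    have /eqP : ip (M *m col j Y) (M *m col j Y) = 0.
      by rewrite ipf dj expr0n mulr0.
    by rewrite ip_eq0 => /eqP ->; rewrite mxE dj mulr0.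
  by rewrite gf ?inE // /f [in RHS]mxE; field.
- move=> i; exact: nth_svals b' d0 dn.
Qed.
End SingularValues.

Section KyFan.
Variable C : numClosedFieldType.

Lemma threshold_le n k (d c : 'I_n -> C) s (j : 'I_n) :
    ((j < k)%N -> s <= d j) -> ((k <= j)%N -> d j <= s) -> 0 <= c j <= 1 ->
  0 <= (d j - s) * ((j < k)%:R - c j).
Proof.
move=> h1 h2 /andP[c0 c1]; case: ltnP => jk.
  by rewrite mulr_ge0 ?subr_ge0 // h1.
by rewrite mulr_le0 ?subr_le0 // h2.
Qed.

Lemma threshold_sum n k (d c : 'I_n -> C) s : (k <= n)%N ->
  \sum_j (d j - s) * ((j < k)%:R - c j) =
  \sum_(j < n | (j < k)%N) d j - \sum_j d j * c j - s * (k%:R - \sum_j c j).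
Proof.
move=> kn; have -> : k%:R = \sum_(j < n) (j < k)%:R :> C.
  transitivity (\sum_(j < n | (j < k)%N) (1 : C)).
    by rewrite -(big_ord_widen n (fun=> 1)) // sumr_const card_ord.
  by rewrite big_mkcond; apply: eq_bigr => j _; case: ifP.
have -> : \sum_(j < n | (j < k)%N) d j = \sum_j d j * (j < k)%:R.
  by rewrite big_mkcond; apply: eq_bigr => j _; case: ifP; rewrite ?mulr1 ?mulr0.
rewrite -!sumrB mulr_sumr -sumrB; apply: eq_bigr => j _; ring.
Qed.

Lemma kyfan_sum n k (M : 'M[C]_n) (d : 'I_n -> C) : (k <= n)%N ->
  (forall i : 'I_n, (svals M)`_i = d i) -> kyfan k M = \sum_(j < n | (j < k)%N) d j.
Proof.
move=> kn e; rewrite /kyfan (big_ord_widen n (fun i => (svals M)`_i)) //.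
by apply: eq_bigr => j _.
Qed.

Lemma kyfan_ge0 n k (M : 'M[C]_n) : (k <= n)%N -> 0 <= kyfan k M.
Proof.
move=> kn; have [X [Y [d [[_ _ _ svM d0] _]]]] := svd M.
by rewrite (kyfan_sum kn svM) sumr_ge0.
Qed.

Lemma parseval n (V : 'M[C]_n) (x : 'cV[C]_n) : V \is unitarymx ->
  \sum_j `|ip (col j V) x| ^+ 2 = ip x x.
Proof.
move=> uV; have uV' : adjmx V \is unitarymx by rewrite trmxC_unitary.
rewrite -(unitary_ip x x uV') ipE; apply: eq_bigr => j _.
rewrite normCKC; suff -> : ip (col j V) x = (adjmx V *m x) j 0 by [].
by rewrite ipE mxE; apply: eq_bigr => i _; rewrite adjmxE mxE.
Qed.

Lemma bessel n k (f : 'I_k -> 'cV[C]_n) (y : 'cV[C]_n) : orthonormal_fam f ->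
  \sum_i `|ip (f i) y| ^+ 2 <= ip y y.
Proof.
move=> fo; pose z := \sum_i ip (f i) y *: f i.
have fz i : ip (f i) z = ip (f i) y.
  rewrite ip_sumr (bigD1 i) //= big1 => [|j /negbTE ji]; rewrite ipZr fo.
    by rewrite eqxx mulr1 addr0.
  by rewrite eq_sym ji mulr0.
have zE w : (forall i, ip (f i) w = ip (f i) y) ->
    ip z w = \sum_i `|ip (f i) y| ^+ 2.
  by move=> h; rewrite ip_suml; apply: eq_bigr => i _; rewrite ipZl h normCKC.
have := ip_ge0 (y - z); rewrite ipBr !(ipDl _ (- z)) !ipNl -[ip y z]ip_conj.
rewrite (zE y) // (zE z) // rmorph_sum /=.
under [X in _ - (X - _)]eq_bigr do rewrite rmorphXn /= conj_normC.
by rewrite subrr subr0 subr_ge0.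
Qed.

Lemma kyfan_dual n k (M : 'M[C]_n) (x u : 'I_k -> 'cV[C]_n) : (1 <= k <= n)%N ->
    orthonormal_fam x -> orthonormal_fam u ->
  `|\sum_i ip (x i) (M *m u i)| <= kyfan k M.
Proof.
move=> /andP[k0 kn] xo uo; have [X [Y [d [[uX uY e svM d0] dn]]]] := svd M.
rewrite (kyfan_sum kn svM).
pose a i j := ip (x i) (col j X); pose b i j := ip (col j Y) (u i).
pose c j := \sum_i (`|a i j| ^+ 2 + `|b i j| ^+ 2) / 2.
have xMu i : ip (x i) (M *m u i) = \sum_j d j * (a i j * b i j).
  have -> : M *m u i = \sum_j (d j * b i j) *: col j X.
    rewrite -[u i]mul1mx -(unitary_mulmx_adj uY) !mulmxA e.
    apply/matrixP=> l z; rewrite ord1 summxE -mulmxA mxE mul_mx_diag.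
    apply: eq_bigr => j _; rewrite !mxE /b ipE.
    rewrite -mulrA mulrC; congr (_ * _ * _).
    by apply: eq_bigr => t _; rewrite adjmxE mxE.
  by rewrite ip_sumr; apply: eq_bigr => j _; rewrite ipZr /a; ring.
have c0 j : 0 <= c j.
  by apply: sumr_ge0 => i _; rewrite divr_ge0 ?ler0n // addr_ge0 // exprn_ge0.
have cE j : c j = (\sum_i `|a i j| ^+ 2 + \sum_i `|b i j| ^+ 2) / 2.
  by rewrite -big_split mulr_suml.
have half1 (p q : C) : p <= 1 -> q <= 1 -> (p + q) / 2 <= 1.
  by move=> p1 q1; rewrite ler_pdivrMr ?ltr0n // mul1r lerD.
have c1 j : c j <= 1.
  rewrite cE half1 //.
    by rewrite (le_trans (bessel (col j X) xo)) // unitary_ip_col // eqxx.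
  apply: le_trans (_ : \sum_i `|ip (u i) (col j Y)| ^+ 2 <= _).
    by apply: ler_sum => i _; rewrite /b -ip_conj norm_conjC.
  by rewrite (le_trans (bessel _ uo)) // unitary_ip_col // eqxx.
have cs : \sum_j c j = k%:R.
  rewrite exchange_big /= -[k in RHS]card_ord -sumr_const; apply: eq_bigr => i _.
  rewrite -mulr_suml big_split /= /b parseval // uo eqxx mulr1n.
  under eq_bigr do rewrite /a -ip_conj norm_conjC.
  by rewrite parseval // xo eqxx mulr1n; field.
apply: le_trans (_ : \sum_j d j * c j <= _).
  under eq_bigr do rewrite xMu.
  rewrite exchange_big /=; apply: le_trans (ler_norm_sum _ _ _) _.
  apply: ler_sum => j _; rewrite -mulr_sumr normrM ger0_norm //.
  apply: ler_wpM2l => //; apply: le_trans (ler_norm_sum _ _ _) _.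
  apply: ler_sum => i _; rewrite normrM -subr_ge0.
  have -> : (`|a i j| ^+ 2 + `|b i j| ^+ 2) / 2 - `|a i j| * `|b i j| =
    (`|a i j| - `|b i j|) ^+ 2 / 2 by field.
  by rewrite divr_ge0 ?ler0n // real_exprn_even_ge0 // rpredB ?normr_real.
have lk : (k.-1 < n)%N by rewrite prednK.
pose s := d (Ordinal lk).
have : 0 <= \sum_j (d j - s) * ((j < k)%:R - c j).
  apply: sumr_ge0 => j _; apply: threshold_le; rewrite ?c0 ?c1 // => jk; apply: dn => /=.
    by rewrite -ltnS prednK.
  exact: leq_trans (leq_pred _) jk.
by rewrite threshold_sum // cs subrr mulr0 subr0 subr_ge0.
Qed.

Lemma bj_orth_of_frame n k (A B U P : 'M[C]_n) (u : 'I_k -> 'cV[C]_n) :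
    (1 <= k <= n)%N -> U \is unitarymx -> A = U *m P -> orthonormal_fam u ->
    (forall i : 'I_k, P *m u i = (svals A)`_i *: u i) ->
    \sum_(i < k) ip (u i) (adjmx U *m B *m u i) = 0 ->
  bj_orth (fun M : 'M[C]_n => kyfan k M) A B.
Proof.
move=> kn uU AUP uo Pu uBu lam; pose x i := U *m u i.
have xo : orthonormal_fam x by move=> i j; rewrite unitary_ip.
apply: le_trans (kyfan_dual (A + lam *: B) kn xo uo).
rewrite -(ger0_norm (kyfan_ge0 A _)); last by case/andP: kn.
rewrite le_eqVlt; apply/orP; left; apply/eqP; congr `| _ |.
have -> : \sum_i ip (x i) ((A + lam *: B) *m u i) =
    \sum_i ip (u i) (P *m u i) + lam * \sum_(i < k) ip (u i) (adjmx U *m B *m u i).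
  rewrite mulr_sumr -big_split; apply: eq_bigr => i _ /=.
  rewrite mulmxDl ipDr -scalemxAl ipZr AUP /x -mulmxA unitary_ip //.
  by rewrite [in LHS](ip_mul U) mulmxA.
rewrite uBu mulr0 addr0; apply: eq_bigr => i _.
by rewrite Pu ipZr uo eqxx mulr1.
Qed.
End KyFan.

Section Rounding.
Variable C : numClosedFieldType.

Lemma toeplitz_hausdorff2 n (Y : 'M[C]_n) (x y : 'cV[C]_n) al : 0 <= al <= 1 ->
  exists a b, a^* * a + b^* * b = 1 /\
    ip (a *: x + b *: y) (Y *m (a *: x + b *: y)) =
      al * ip x (Y *m x) + (1 - al) * ip y (Y *m y).
Proof.
move=> /andP[al0 al1]; pose p := ip x (Y *m x); pose q := ip y (Y *m y).
pose c := al * p + (1 - al) * q; rewrite -/p -/q -/c.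
have l01 : lift ord0 ord0 = 1 :> 'I_2 by apply/val_inj.
pose Z : 'M[C]_2 := \matrix_(i, j) ip (if i == 0 then x else y)
   (Y *m (if j == 0 then x else y)).
have ipZ (w : 'cV[C]_2) : ip w ((Z - c%:M) *m w) =
    ip (w 0 0 *: x + w 1 0 *: y) (Y *m (w 0 0 *: x + w 1 0 *: y))
      - c * ((w 0 0)^* * w 0 0 + (w 1 0)^* * w 1 0).
  rewrite mulmxBl ipBr mul_scalar_mx ipZr; congr (_ - c * _); last first.
    by rewrite ipE !big_ord_recl big_ord0 addr0 l01.
  rewrite ipE !big_ord_recl big_ord0 addr0 !mxE !big_ord_recl !big_ord0 !addr0 !mxE /=.
  rewrite l01 /= mulmxDr -!scalemxAr !(ipDl, ipDr, ipZl, ipZr); ring.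
have [[w w0 wZ]|[th hth]] := numerical_range_alt (Z - c%:M).
  have [e e0 ew] := normalize w0; set v := e *: w in ew.
  have vZ : ip v ((Z - c%:M) *m v) = 0.
    by rewrite /v -scalemxAr ipZl ipZr wZ !mulr0.
  have nv : (v 0 0)^* * v 0 0 + (v 1 0)^* * v 1 0 = 1.
    by rewrite -[RHS]ew ipE !big_ord_recl big_ord0 addr0 l01.
  exists (v 0 0), (v 1 0); split=> //.
  by apply/eqP; rewrite -subr_eq0 -[c]mulr1 -nv -ipZ vZ.
have d0 : delta_mx 0 0 != 0 :> 'cV[C]_2.
  by apply/cV0Pn; exists 0; rewrite mxE !eqxx oner_eq0.
have d1 : delta_mx 1 0 != 0 :> 'cV[C]_2.
  by apply/cV0Pn; exists 1; rewrite mxE !eqxx oner_eq0.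
have h0 := hth _ d0; have h1 := hth _ d1.
move: h0 h1; rewrite !ipZ !mxE /= !mulr1n !mulr0n ?(scale0r, scale1r, addr0, add0r).
rewrite conjC0 conjC1 !mulr1 !mul0r ?addr0 ?add0r ?mulr1.
rewrite -/p -/q => h0 h1.
have e : al * (th * (p - c) + (th * (p - c))^*) +
    (1 - al) * (th * (q - c) + (th * (q - c))^*) = 0.
  have gen (z1 z2 : C) : al * (z1 + z1^*) + (1 - al) * (z2 + z2^*) =
      al * z1 + (1 - al) * z2 + (al * z1 + (1 - al) * z2)^*.
    have alr := CrealP (ger0_real al0).
    by rewrite rmorphD !rmorphM rmorphB /= alr conjC1; ring.
  rewrite gen; have -> : al * (th * (p - c)) + (1 - al) * (th * (q - c)) = 0.
    by rewrite /c; ring.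
  by rewrite conjC0 addr0.
have [al_0|aln] := eqVneq al 0.
  by move: e h1; rewrite al_0 mul0r add0r subr0 mul1r => ->; rewrite ltxx.
have pos : 0 < al * (th * (p - c) + (th * (p - c))^*) by rewrite mulr_gt0 // lt0r aln.
have nneg : 0 <= (1 - al) * (th * (q - c) + (th * (q - c))^*).
  by rewrite mulr_ge0 ?subr_ge0 // ltW.
by have := ltr_wpDr nneg pos; rewrite e ltxx.
Qed.

(* Convexity of the numerical range provides a rotated frame carrying the total
   weight d1 + d2 with one weight equal to 0 or 1. *)
Lemma merge_weights n (Y : 'M[C]_n) (x y : 'cV[C]_n) (d1 d2 : C) :
    ip x x = 1 -> ip y y = 1 -> ip x y = 0 -> 0 < d1 < 1 -> 0 < d2 < 1 ->
  exists a b e1 e2, let x' := a *: x + b *: y in let y' := a^* *: y - b^* *: x in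
   [/\ [/\ ip x' x' = 1, ip y' y' = 1 & ip x' y' = 0],
     [/\ 0 <= e1 <= 1, 0 <= e2 <= 1 & (e1 == 1) || (e2 == 0)],
     e1 + e2 = d1 + d2 &
     e1 * ip x' (Y *m x') + e2 * ip y' (Y *m y') =
     d1 * ip x (Y *m x) + d2 * ip y (Y *m y)].
Proof.
move=> xx yy xy /andP[d1p d11] /andP[d2p d21].
have yx : ip y x = 0 by rewrite -ip_conj xy conjC0.
have dp : 0 < d1 + d2 by rewrite addr_gt0.
have dr : d1 + d2 \is Num.real by rewrite gtr0_real.
have [e1 [e2 [al [[al01 e10 e20 one es] eal]]]] : exists e1 e2 al,
   [/\ 0 <= al <= 1, 0 <= e1 <= 1, 0 <= e2 <= 1, (e1 == 1) || (e2 == 0) & e1 + e2 = d1 + d2] /\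
   e1 * al + e2 * (1 - al) = d1.
  have [le1|gt1] := real_leP dr (@real1 C).
    exists (d1 + d2), 0, (d1 / (d1 + d2)).
    rewrite !lexx ler01 le1 (ltW dp) eqxx orbT addr0; split; last by field; rewrite gt_eqF.
    by split=> //; rewrite divr_ge0 ?(ltW dp) ?(ltW d1p) // ler_pdivrMr // mul1r lerDl ltW.
  have up : 0 < 2 - d1 - d2.
    have -> : 2 - d1 - d2 = (1 - d1) + (1 - d2) by ring.
    by rewrite addr_gt0 ?subr_gt0.
  exists 1, (d1 + d2 - 1), ((1 - d2) / (2 - d1 - d2)).
  rewrite lexx ler01 eqxx subr_ge0 (ltW gt1); split; last by field; rewrite gt_eqF.
  split=> //; last by ring.
    have d2c : 0 <= 1 - d2 by rewrite subr_ge0 ltW.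
    rewrite divr_ge0 ?(ltW up) //= ler_pdivrMr // mul1r -subr_ge0.
    have -> : 2 - d1 - d2 - (1 - d2) = 1 - d1 by ring.
    by rewrite subr_ge0 ltW.
  rewrite -subr_ge0; have -> : 1 - (d1 + d2 - 1) = 2 - d1 - d2 by ring.
  exact: ltW.
have [a [b [ab Yab]]] := toeplitz_hausdorff2 Y x y al01.
exists a, b, e1, e2 => x' y'.
have tr : ip x' (Y *m x') + ip y' (Y *m y') = ip x (Y *m x) + ip y (Y *m y).
  rewrite /x' /y' !(mulmxDr, mulmxN) -!scalemxAr.
  rewrite !(ipDl, ipDr, ipBr, ipNl, ipNr, ipZl, ipZr) !conjCK.
  have -> : ip x (Y *m x) + ip y (Y *m y) =
    (a^* * a + b^* * b) * (ip x (Y *m x) + ip y (Y *m y)) by rewrite ab mul1r.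
  ring.
have Yy' : ip y' (Y *m y') = (1 - al) * ip x (Y *m x) + al * ip y (Y *m y).
  have -> : ip y' (Y *m y') = ip x (Y *m x) + ip y (Y *m y) - ip x' (Y *m x').
    by rewrite -tr addrC addKr.
  by rewrite Yab; ring.
split=> //.
- rewrite /x' /y' !(ipDl, ipDr, ipBr, ipNl, ipNr, ipZl, ipZr) !conjCK xx yy xy yx.
  by split; [rewrite -[RHS]ab|rewrite -[RHS]ab|]; ring.
- have -> : d2 = e1 + e2 - d1 by rewrite es addrC addKr.
  by rewrite Yy' Yab -eal; ring.
Qed.

Lemma round_weights n k (P Y : 'M[C]_n) (sg d : 'I_n -> C) (s : C)
    (g : 'I_n -> 'cV[C]_n) :
    (forall i j, ip (g i) (g j) = (i == j)%:R) ->
    (forall i, P *m g i = sg i *: g i) ->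
    (forall i, 0 <= d i <= 1) -> \sum_i d i = k%:R ->
    (forall i, sg i != s -> (d i == 0) || (d i == 1)) ->
    \sum_i d i * ip (g i) (Y *m g i) = 0 ->
  exists (g' : 'I_n -> 'cV[C]_n) (T : {set 'I_n}),
    [/\ forall i j, ip (g' i) (g' j) = (i == j)%:R,
        forall i, P *m g' i = sg i *: g' i, #|T| = k,
        \sum_(i in T) sg i = \sum_i sg i * d i &
        \sum_(i in T) ip (g' i) (Y *m g' i) = 0].
Proof.
pose frac (d : 'I_n -> C) := [set i | ~~ ((d i == 0) || (d i == 1))].
have [r] := ubnP #|frac d|; elim: r d g => // r IHr d g fr go gP d01 ds ds01 dY.
pose T := [set i | d i == 1].
have dT (w : 'I_n -> C) : frac d = set0 -> \sum_i d i * w i = \sum_(i in T) w i.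
  move=> f0; rewrite [RHS]big_mkcond; apply: eq_bigr => i _; rewrite inE.
  have := in_set0 i; rewrite -f0 inE => /negbFE/orP[]/eqP->.
    by rewrite mul0r eq_sym oner_eq0.
  by rewrite mul1r eqxx.
have [f0|[i fi]] := set_0Vmem (frac d).
  exists g, T; split=> //.
  - apply/eqP; rewrite -(eqr_nat C) -ds -sumr_const -dT //; apply/eqP.
    by apply: eq_bigr => i _; rewrite mulr1.
  - by rewrite -dT //; apply: eq_bigr => i _; rewrite mulrC.
  - by rewrite -dT.
have fracP l : l \in frac d -> 0 < d l < 1.
  rewrite inE negb_or => /andP[l0 l1]; have /andP[h0 h1] := d01 l.
  by rewrite !lt_neqAle eq_sym l0 l1 h0 h1.
have [j ji fj] : exists2 j, j != i & j \in frac d.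
  apply/exists_inP; apply: contraT; rewrite negb_exists_in => /forall_inP nf.
  have sT : #|T|%:R = \sum_(j | j != i) d j.
    rewrite -sumr_const big_mkcond (bigD1 i) //= inE.
    have /andP[_ /lt_eqF ->] := fracP i fi; rewrite add0r.
    apply: eq_bigr => j ji; rewrite inE.
    have := nf j ji; rewrite inE negbK => /orP[]/eqP->; rewrite ?eqxx // eq_sym.
    by rewrite oner_eq0.
  have di : d i = k%:R - #|T|%:R by rewrite sT -ds (bigD1 i) //= addrK.
  have := fracP i fi; rewrite di subr_gt0 ltr_nat ltrBlDl natr1 ltr_nat ltnS.
  by move=> /andP[h1 h2]; have := leq_trans h1 h2; rewrite ltnn.
have sgs l : l \in frac d -> sg l = s.
  by rewrite inE => fl; apply/eqP; apply: contraNT fl => /ds01.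
have gii l : ip (g l) (g l) = 1 by rewrite go eqxx.
have gij : ip (g i) (g j) = 0 by rewrite go eq_sym (negbTE ji).
have [a [b [e1 [e2 [[xx yy xy] [e10 e20 one] es eY]]]]] :=
  merge_weights Y (gii i) (gii j) gij (fracP i fi) (fracP j fj).
set x' := _ + _ in xx xy eY; set y' := _ - _ in yy xy eY.
pose g' l := if l == i then x' else if l == j then y' else g l.
pose d' l := if l == i then e1 else if l == j then e2 else d l.
have sumd (w w' : 'I_n -> C) : (forall l, l != i -> l != j -> w' l = w l) ->
    \sum_l d' l * w' l = \sum_l d l * w l +
      (e1 * w' i + e2 * w' j - (d i * w i + d j * w j)).
  move=> ww; rewrite (bigD1 i) //= (bigD1 j) //= [in RHS](bigD1 i) //= [in RHS](bigD1 j) //=.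
  rewrite /d' !eqxx (negbTE ji).
  rewrite (eq_bigr (fun l => d l * w l)); first by ring.
  by move=> l /andP[li lj]; rewrite (negbTE li) (negbTE lj) ww.
have gx l : l != i -> l != j -> ip (g l) x' = 0.
  by move=> li lj; rewrite ipDr !ipZr !go (negbTE li) (negbTE lj) !mulr0 addr0.
have gy l : l != i -> l != j -> ip (g l) y' = 0.
  by move=> li lj; rewrite ipBr !ipZr !go (negbTE li) (negbTE lj) !mulr0 subr0.
have xg l : l != i -> l != j -> ip x' (g l) = 0.
  by move=> li lj; rewrite -ip_conj gx // conjC0.
have yg l : l != i -> l != j -> ip y' (g l) = 0.
  by move=> li lj; rewrite -ip_conj gy // conjC0.
have yx : ip y' x' = 0 by rewrite -ip_conj xy conjC0.
have ij : i != j by rewrite eq_sym.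
have [|||||||g1 [T1 [g1o g1P T1k sT1 Y1]]] := IHr d' g'.
- apply: leq_trans (_ : (#|frac d| <= r)%N); last by rewrite -ltnS.
  apply: proper_card; apply/properP; split.
    apply/subsetP=> l; rewrite !inE /d'; case: (l =P i) => [->|_].
      by move=> _; move: fi; rewrite inE.
    by case: (l =P j) => [->|_] //; move=> _; move: fj; rewrite inE.
  case/orP: one => e.
    by exists i => //; rewrite inE /d' eqxx e orbT.
  by exists j => //; rewrite inE /d' (negbTE ji) eqxx e.
- move=> l m; rewrite /g'.
  case: (l =P i) => [->|/eqP li]; last case: (l =P j) => [->|/eqP lj].
  + case: (m =P i) => [->|/eqP mi]; first by rewrite xx eqxx.
    case: (m =P j) => [->|/eqP mj]; first by rewrite xy (negbTE ij).
    by rewrite xg // eq_sym (negbTE mi).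
  + case: (m =P i) => [->|/eqP mi]; first by rewrite yx (negbTE ji).
    case: (m =P j) => [->|/eqP mj]; first by rewrite yy eqxx.
    by rewrite yg // eq_sym (negbTE mj).
  + case: (m =P i) => [->|/eqP mi]; first by rewrite gx // (negbTE li).
    case: (m =P j) => [->|/eqP mj]; first by rewrite gy // (negbTE lj).
    exact: go.
- have Ps a0 b0 : P *m (a0 *: g i + b0 *: g j) = s *: (a0 *: g i + b0 *: g j).
    rewrite mulmxDr -!scalemxAr !gP !sgs // scalerDr !scalerA.
    by congr (_ *: _ + _ *: _); rewrite mulrC.
  move=> l; rewrite /g'; case: eqP => [->|_]; first by rewrite sgs // Ps.
  case: eqP => [->|_]; last exact: gP.
  by rewrite sgs // /y' -scaleNr addrC Ps.
- move=> l; rewrite /d'; case: (l =P i) => // _; case: (l =P j) => // _; exact: d01.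
- have := sumd (fun=> 1) (fun=> 1) (fun _ _ _ => erefl).
  under eq_bigr do rewrite mulr1; under [in RHS]eq_bigr do rewrite mulr1.
  by move=> ->; rewrite ds !mulr1 es subrr addr0.
- move=> l sl; rewrite /d'; case: (l =P i) => [li|_].
    by move: sl; rewrite li sgs ?eqxx.
  case: (l =P j) => [lj|_]; last exact: ds01.
  by move: sl; rewrite lj sgs ?eqxx.
- have := sumd (fun l => ip (g l) (Y *m g l)) (fun l => ip (g' l) (Y *m g' l)).
  rewrite dY add0r => ->.
    by rewrite /g' !eqxx (negbTE ji) eY subrr.
  by move=> l li lj; rewrite /g' (negbTE li) (negbTE lj).
exists g1, T1; split=> //.
rewrite sT1; under eq_bigr do rewrite mulrC; rewrite (sumd sg sg) //.
rewrite !sgs // -!mulrDl es subrr addr0.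
by apply: eq_bigr => l _; rewrite mulrC.
Qed.
End Rounding.

Section Converse.
Variable C : numClosedFieldType.

Lemma ip_col_mx m n (x y : 'cV[C]_m) (z w : 'cV[C]_n) :
  ip (col_mx x z) (col_mx y w) = ip x y + ip z w.
Proof. by rewrite /ip /adjmx tr_col_mx map_row_mx mul_row_col mxE. Qed.

(* The forms [diag (sg, - sg)] and K on C^n + C^n are the hermitian dilations of
   [diag sg] and X in the rotated frame ((x + y) / 2, (x - y) / 2): they turn
   singular values into eigenvalues. *)
Lemma critical_density n k (sg : 'I_n -> C) (X : 'M[C]_n) (s : C) : (k <= n)%N ->
    (forall i, 0 <= sg i) -> 0 < s ->
    (forall i : 'I_n, (i < k)%N -> s <= sg i) ->
    (forall i : 'I_n, (k <= i)%N -> sg i <= s) ->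
    (forall lam, \sum_(i < n | (i < k)%N) sg i <=
       kyfan k (diag_mx (\row_i sg i) + lam *: X)) ->
  exists D, [/\ density k D, forall i j, sg i < s -> D i j = 0,
     forall i j, s < sg i -> D i j = (i == j)%:R & \tr (X *m D) = 0].
Proof.
move=> kn sg0 s0 sgk sgnk crit; set P := diag_mx _ in crit.
pose h (i : 'I_(n + n)) := match split i with inl j => sg j | inr j => - sg j end.
have hl j : h (lshift n j) = sg j by rewrite /h (unsplitK (inl j)).
have hr j : h (rshift n j) = - sg j by rewrite /h (unsplitK (inr j)).
pose K : 'M[C]_(n + n) := block_mx X (- X) X (- X).
pose T := [set lshift n j | j : 'I_n & (j < k)%N].
have inT j : (lshift n j \in T) = (j < k)%N.
  apply/imsetP/idP => [[l]|jk]; last by exists j; rewrite ?inE.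
  by rewrite inE => lk /lshift_inj ->.
have ninT j : rshift n j \notin T.
  by apply/imsetP => -[l _ /eqP]; rewrite eq_rlshift.
have Tk : #|T| = k.
  rewrite card_imset; last exact: lshift_inj.
  by rewrite cardsE -sum1_card -(big_ord_widen n (fun=> 1%N)) // sum1_card card_ord.
have Tsum : \sum_(i in T) h i = \sum_(i < n | (i < k)%N) sg i.
  rewrite big_imset /=; last by move=> ? ? _ _; apply: lshift_inj.
  by apply: eq_big => [i|i _]; rewrite ?inE ?hl.
have sgr i : sg i \is Num.real by rewrite ger0_real.
have sr : s \is Num.real by rewrite gtr0_real.
have ss j : - sg j < s by rewrite (le_lt_trans _ s0) // oppr_le0.
have [||||[D [[Dh Dtr D01] Dlo Dhi KD]]|[lam hlam]] := @top_sum_alt C _ h T s K.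
- exact: sr.
- by move=> i; rewrite /h; case: split => j; rewrite ?realN.
- move=> i iT; case: (split_ordP i) iT => j ->; rewrite ?hl ?inT; first exact: sgk.
  by rewrite (negbTE (ninT j)).
- move=> i iT; case: (split_ordP i) iT => j ->; rewrite ?hl ?hr ?inT.
    by rewrite -leqNgt; apply: sgnk.
  by move=> _; apply: ltW.
- exists (ulsubmx D).
  have dl0 : dlsubmx D = 0.
    by apply/matrixP=> i j; rewrite !mxE Dlo // hr.
  have dr0 : drsubmx D = 0.
    by apply/matrixP=> i j; rewrite !mxE Dlo // hr.
  have ur0 : ursubmx D = 0.
    apply/matrixP=> i j; rewrite !mxE -Dh adjmxE Dlo ?hr // conjC0 //.
  have DE : D = block_mx (ulsubmx D) 0 0 0 by rewrite -{1}[D]submxK dl0 dr0 ur0.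
  split; [split| | |].
  + apply/matrixP=> i j; rewrite adjmxE.
    have /matrixP/(_ (lshift n i) (lshift n j)) := Dh.
    by rewrite adjmxE !mxE.
  + by rewrite -Tk -Dtr DE mxtrace_block mxtrace0 addr0 block_mxKul.
  + move=> x; have := D01 (col_mx x 0).
    have -> : ip (col_mx x 0) (D *m col_mx x 0) = ip x (ulsubmx D *m x).
      by rewrite {1}DE mul_block_col !mul0mx !addr0 ip_col_mx ip0r addr0.
    by rewrite ip_col_mx ip0r addr0.
  + by move=> i j sgi; rewrite !mxE Dlo // hl.
  + by move=> i j sgi; rewrite !mxE Dhi ?hl // (inj_eq (@lshift_inj _ _)).
  + have := KD; rewrite {1}DE /K mulmx_block !mulmx0 !addr0 mxtrace_block mxtrace0 addr0.
    by [].
exfalso.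
have [U [V [d [[uU uV e svM d0] _]]]] := svd (P + (2 * lam) *: X).
pose x i := col i U; pose y i := col i V.
pose f (i : nat) : 'cV[C]_(n + n) :=
  if insub i is Some j then 2^-1 *: col_mx (x j + y j) (x j - y j) else 0.
have fE (j : 'I_n) : f j = 2^-1 *: col_mx (x j + y j) (x j - y j).
  by rewrite /f valK.
have xo i j : ip (x i) (x j) = (i == j)%:R by exact: unitary_ip_col.
have yo i j : ip (y i) (y j) = (i == j)%:R by exact: unitary_ip_col.
have half : (2^-1 : C)^* = 2^-1 by rewrite fmorphV /= conjC_nat.
have HE : diag_mx (\row_j h j) = block_mx P 0 0 (- P).
  have -> : \row_j h j = row_mx (\row_j sg j) (- \row_j sg j).
    apply/rowP=> i; case: (split_ordP i) => j ->; rewrite mxE ?hl ?hr.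
      by rewrite row_mxEl mxE.
    by rewrite row_mxEr !mxE.
  by rewrite diag_mx_row raddfN.
have Pxy a b : ip a (P *m b) = ip (P *m a) b.
  by rewrite ip_adj adjmx_diag // => i; rewrite mxE.
have conj4 (i : 'I_n) : ip (x i) (P *m y i) + ip (y i) (P *m x i) =
    ip (f i) (diag_mx (\row_j h j) *m f i) * 2.
  rewrite fE HE -scalemxAr ipZl ipZr half mul_block_col !mul0mx addr0 add0r mulNmx.
  rewrite ip_col_mx ipNr !(mulmxDr, mulmxN) !(ipDl, ipDr, ipNl, ipNr).
  by field.
have KE (i : 'I_n) : ip (f i) (K *m f i) = ip (x i) (X *m y i).
  rewrite fE -scalemxAr ipZl ipZr half mul_block_col !mulNmx ip_col_mx -ipDl.
  rewrite -mulmxBr.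
  have -> : x i + y i + (x i - y i) = 2 *: x i by rewrite addrACA addrN addr0 scaler_nat.
  have -> : x i + y i - (x i - y i) = 2 *: y i.
    by rewrite opprD opprK addrACA addrN add0r scaler_nat.
  by rewrite -scalemxAr ipZl ipZr conjC_nat; field.
have fo i j : (i < #|T|)%N -> (j < #|T|)%N -> ip (f i) (f j) = (i == j)%:R.
  rewrite Tk => ik jk; have ni := leq_trans ik kn; have nj := leq_trans jk kn.
  rewrite -[i]/(val (Ordinal ni)) -[j]/(val (Ordinal nj)) !fE ipZl ipZr half ip_col_mx.
  rewrite !(ipDl, ipDr, ipNl, ipNr) !xo !yo -val_eqE /=.
  by field.
have dE (i : 'I_n) : (d i) *+ 2 = ip (f i) (diag_mx (\row_j h j) *m f i) *+ 2 +
  ((2 * lam) * ip (f i) (K *m f i) + ((2 * lam) * ip (f i) (K *m f i))^*).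
  have dxy : d i = ip (x i) ((P + (2 * lam) *: X) *m y i).
    have -> : (P + (2 * lam) *: X) *m y i = d i *: x i.
      rewrite /x /y !colE mulmxA e -mulmxA -colE scalemxAr; congr (_ *m _).
      apply/matrixP=> l z; rewrite ord1 !mxE eqxx andbT.
      by case: eqP => [->|_]; rewrite ?mulr1n ?mulr1 ?mulr0n ?mulr0.
    by rewrite ipZr xo eqxx mulr1.
  have dr := CrealP (ger0_real (d0 i)).
  have -> : d i *+ 2 = d i + (d i)^* by rewrite dr mulr2n.
  have -> : ip (f i) (diag_mx (\row_j h j) *m f i) *+ 2 =
      ip (x i) (P *m y i) + (ip (x i) (P *m y i))^*.
    by rewrite -mulr_natr -conj4 ip_conj (Pxy (y i)).
  rewrite dxy KE mulmxDl ipDr -scalemxAl ipZr rmorphD /=.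
  by rewrite addrACA.
have {}dE (i : 'I_n) : d i = ip (f i) (diag_mx (\row_j h j) *m f i) +
    (lam * ip (f i) (K *m f i) + (lam * ip (f i) (K *m f i))^*).
  have two0 : (2 : C) != 0 by rewrite pnatr_eq0.
  apply: (mulIf two0); rewrite mulr_natr dE -[_ *+ 2]mulr_natr.
  by rewrite !rmorphM /= conjC_nat; ring.
have := lt_le_trans (hlam f fo) (_ : _ <= kyfan k (P + (2 * lam) *: X)).
rewrite Tsum => /(_ (crit _)); rewrite (kyfan_sum kn svM) /= Tk.
rewrite (big_ord_widen n (fun i => ip (f i) (K *m f i))) //.
rewrite (big_ord_widen n (fun i => ip (f i) (diag_mx (\row_j h j) *m f i))) //.
rewrite mulr_sumr rmorph_sum -!big_split /= (eq_bigr d) ?ltxx //.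
Qed.
End Converse.

Section Frames.
Variable C : numClosedFieldType.

Lemma leq_enum_val n (T : {set 'I_n}) (i : 'I_#|T|) : (i <= enum_val i)%N.
Proof.
have sT : sorted ltn (map val (enum T)).
  have : sorted ltn (map val (enum 'I_n)) by rewrite val_enum_ord iota_ltn_sorted.
  rewrite !sorted_map => sI; rewrite /enum_mem; apply: sorted_filter.
    by move=> ? ? ?; apply: ltn_trans.
  exact: sI.
have nthE l : (l < #|T|)%N -> (l <= nth 0%N (map val (enum T)) l)%N.
  elim: l => // l IHl lT; apply: leq_ltn_trans (IHl (ltnW lT)) _.
  by apply: (sorted_ltn_nth ltn_trans); rewrite ?inE ?size_map -?cardE // ltnW.
have := nthE i (ltn_ord i); by rewrite (nth_map (enum_default i)) -?cardE.
Qed.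

Lemma sorted_spectrum_unique n (M V W : 'M[C]_n) (d e : 'I_n -> C) :
    eigenbasis M V d -> eigenbasis M W e -> nonincreasing d -> nonincreasing e ->
    (forall i, 0 <= d i) -> (forall i, 0 <= e i) ->
  d =1 e.
Proof.
move=> bd be dn en d0 e0 i.
have sq Z c : eigenbasis M Z c -> (forall i, 0 <= c i) ->
    eigenbasis (adjmx M *m M) Z (fun i => c i ^+ 2).
  move=> b c0; have [uZ _] := b; apply: eigenbasis_of_col => // j.
  have Mh : adjmx M = M.
    rewrite (eigenbasisE b) !adjmxM adjmxK adjmx_diag ?mulmxA // => l.
    by rewrite mxE ger0_real.
  by rewrite Mh -mulmxA !(eigenbasis_col _ b, =^~ scalemxAr) scalerA.
rewrite -(nth_svals i (sq _ _ bd d0) d0 dn).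
exact: nth_svals (sq _ _ be e0) e0 en.
Qed.

(* Commuting hermitian matrices are diagonalised by diagonalising the normal
   matrix D1 + i D2. *)
Lemma codiag_hermitian n (D1 D2 : 'M[C]_n) : adjmx D1 = D1 -> adjmx D2 = D2 ->
    D1 *m D2 = D2 *m D1 ->
  exists V d1 d2, eigenbasis D1 V d1 /\ eigenbasis D2 V d2.
Proof.
move=> h1 h2 c; pose N := D1 + 'i *: D2.
have Na : adjmx N = D1 - 'i *: D2.
  by rewrite adjmxD adjmxZ h1 h2 conjCi scaleNr.
have [|V [d b]] := @normal_eigenbasis _ _ N.
  rewrite Na /N !(mulmxDl, mulmxDr) !(mulmxN, mulNmx) -!scalemxAl -!scalemxAr c.
  by apply/matrixP=> i j; rewrite !mxE; ring.
have [uV _] := b.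
have ba : eigenbasis (adjmx N) V (fun i => (d i)^*).
  split=> //; rewrite (eigenbasisE b) !adjmxM adjmxK -!mulmxA unitary_adjmx // mulmx1.
  congr (_ *m _); apply/matrixP=> i j; rewrite adjmxE !mxE eq_sym.
  by case: eqP => [->|_]; rewrite ?mulr1n ?mulr0n ?conjC0.
exists V, (fun i => (d i + (d i)^*) / 2), (fun i => - 'i * (d i - (d i)^*) / 2).
have i2 := sqrCi C.
split; apply: eigenbasis_of_col => // i.
  have -> : D1 = 2^-1 *: (N + adjmx N).
    by rewrite Na; apply/matrixP=> l j; rewrite !mxE; field.
  rewrite -scalemxAl mulmxDl (eigenbasis_col _ b) (eigenbasis_col _ ba).
  by rewrite -scalerDl scalerA mulrC.
have -> : D2 = (- 'i / 2) *: (N - adjmx N).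
  rewrite Na; apply/matrixP=> l j; rewrite !mxE.
  have -> : - 'i / 2 * (D1 l j + 'i * D2 l j - (D1 l j - 'i * D2 l j)) =
    - ('i ^+ 2) * D2 l j by field.
  by rewrite i2 opprK mul1r.
rewrite -scalemxAl mulmxBl (eigenbasis_col _ b) (eigenbasis_col _ ba).
by rewrite -scalerBl scalerA; congr (_ *: _); ring.
Qed.

Lemma frame_of_density n k (sg : 'I_n -> C) (X D : 'M[C]_n) (s : C) : (k <= n)%N ->
    nonincreasing sg -> (forall i, 0 <= sg i) -> s \is Num.real ->
    (forall i : 'I_n, (i < k)%N -> s <= sg i) ->
    (forall i : 'I_n, (k <= i)%N -> sg i <= s) ->
    density k D -> (forall i j, sg i < s -> D i j = 0) ->
    (forall i j, s < sg i -> D i j = (i == j)%:R) -> \tr (X *m D) = 0 ->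
  exists u : 'I_k -> 'cV[C]_n, [/\ orthonormal_fam u,
    forall (i : 'I_k) (j : 'I_n), i = j :> nat -> diag_mx (\row_l sg l) *m u i = sg j *: u i &
    \sum_i ip (u i) (X *m u i) = 0].
Proof.
move=> kn sgn sg0 sr sgk sgnk [Dh Dtr D01] Dlo Dhi XD; set P := diag_mx _.
have sgr i : sg i \is Num.real by rewrite ger0_real.
have Ph : adjmx P = P by rewrite adjmx_diag // => i; rewrite mxE.
have P0 x : 0 <= ip x (P *m x).
  rewrite ipE sumr_ge0 // => i _; rewrite mul_diag_mx !mxE mulrCA mulr_ge0 //.
  by rewrite mulrC mul_conjC_ge0.
have Poff i j : sg i != s -> i != j -> D i j = 0.
  move=> si ij; have [lt|gt|e] := real_ltgtP (sgr i) sr; first exact: Dlo.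
    by rewrite Dhi // (negbTE ij).
  by rewrite e eqxx in si.
have PD : P *m D = D *m P.
  apply/matrixP=> i j; rewrite mul_diag_mx mul_mx_diag !mxE.
  have [->|ij] := eqVneq i j; first by rewrite mulrC.
  have [si|si] := eqVneq (sg i) s; last by rewrite Poff // mulr0 mul0r.
  have [sj|sj] := eqVneq (sg j) s; first by rewrite si sj mulrC.
  have -> : D i j = 0 by rewrite -Dh adjmxE Poff ?conjC0 // eq_sym.
  by rewrite mulr0 mul0r.
have [V0 [e0 [d0 [be0 bd0]]]] := codiag_hermitian Ph Dh PD.
have e00 i : 0 <= e0 i by rewrite (eigenvalue_form i be0).
have [p en] := sort_perm e00.
have be := eigenbasis_perm p be0; have bd := eigenbasis_perm p bd0.
set V := col_perm p V0 in be bd; set d := d0 \o p in bd.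
have bP : eigenbasis P 1%:M sg.
  split; last by rewrite mulmx1 mul1mx.
  by apply: unitary_of_adjmx; rewrite adjmx_scalar conjC1 mulmx1.
have sge := sorted_spectrum_unique bP be sgn en sg0 (fun i => e00 (p i)).
have [uV _] := bd.
pose g i := col i V.
have go i j : ip (g i) (g j) = (i == j)%:R by exact: unitary_ip_col.
have gP i : P *m g i = sg i *: g i by rewrite sge; exact: eigenbasis_col.
have dE i : d i = ip (g i) (D *m g i) by exact: eigenvalue_form bd.
have d01 i : 0 <= d i <= 1 by have := D01 (g i); rewrite go eqxx dE.
have trD Y : \tr (Y *m D) = \sum_i d i * ip (g i) (Y *m g i).
  rewrite (eigenbasisE bd) !mulmxA mxtrace_mulC !mulmxA.
  apply: eq_bigr => i _; rewrite mul_mx_diag mxE [(\row__ _) _ _]mxE mulrC.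
  congr (_ * _).
  rewrite -mulmxA -ip_col; congr ip.
  by rewrite /g !colE mulmxA.
have ds : \sum_i d i = k%:R.
  rewrite -Dtr -[D]mul1mx trD; apply: eq_bigr => i _.
  by rewrite mul1mx go eqxx mulr1.
have Dii : \sum_i D i i = k%:R by [].
have sgd : \sum_i sg i * d i = \sum_(i < n | (i < k)%N) sg i.
  have -> : \sum_i sg i * d i = \sum_i sg i * D i i.
    transitivity (\tr (P *m D)).
      by rewrite trD; apply: eq_bigr => i _; rewrite gP ipZr go eqxx mulr1 mulrC.
    by apply: eq_bigr => i _; rewrite mul_diag_mx !mxE.
  have := threshold_sum sg (fun i => D i i) s kn.
  rewrite Dii subrr mulr0 subr0 big1.
    by move/esym/eqP; rewrite subr_eq0 => /eqP ->.
  move=> i _; have [lt|gt|->] := real_ltgtP (sgr i) sr; last by rewrite subrr mul0r.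
    rewrite Dlo // subr0; case: ltnP => ik; rewrite ?mulr0 //.
    by rewrite (le_gtF (sgk i ik)) in lt.
  rewrite Dhi // eqxx; case: ltnP => ik; rewrite ?subrr ?mulr0 //.
  by rewrite (le_gtF (sgnk i ik)) in gt.
have frac i : sg i != s -> (d i == 0) || (d i == 1).
  move=> si; have := threshold_sum sg d s kn.
  rewrite ds sgd subrr sub0r subrr mulr0 oppr0 => /eqP.
  rewrite psumr_eq0; last by move=> j _; apply: threshold_le (sgk j) (sgnk j) (d01 j).
  move/allP/(_ i (mem_index_enum i)); rewrite /= mulf_eq0 subr_eq0 (negbTE si) /=.
  by rewrite subr_eq0 eq_sym; case: ltnP => _ ->; rewrite ?orbT.
have [|g' [T [g'o g'P Tk Ts TX]]] := round_weights go gP d01 ds frac (Y := X).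
  by rewrite -trD.
pose t (i : 'I_k) : 'I_n := enum_val (cast_ord (esym Tk) i).
have tge (i : 'I_k) (j : 'I_n) : i = j :> nat -> sg (t i) <= sg j.
  by move=> ij; apply: sgn; rewrite -ij; apply: (leq_enum_val (cast_ord (esym Tk) i)).
have sumT (F : 'I_n -> C) : \sum_(i in T) F i = \sum_(i < k) F (t i).
  rewrite big_enum_val /=; rewrite (reindex (cast_ord (esym Tk))) //.
  by exists (cast_ord Tk) => i _; rewrite ?cast_ordK ?cast_ordKV.
have teq (i : 'I_k) (j : 'I_n) : i = j :> nat -> sg (t i) = sg j.
  have inn (l : 'I_k) : (l < n)%N := leq_trans (ltn_ord l) kn.
  have : \sum_(l < k) (sg (Ordinal (inn l)) - sg (t l)) = 0.
    rewrite sumrB -sumT Ts sgd; apply/eqP; rewrite subr_eq0; apply/eqP.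
    have sgE (l : 'I_n) : sg l = [seq sg l | l <- enum 'I_n]`_l.
      by rewrite (nth_map l) ?size_enum_ord // nth_ord_enum.
    rewrite (eq_bigr (fun l : 'I_n => [seq sg l | l <- enum 'I_n]`_l)) //.
    rewrite -(big_ord_widen n (fun l => [seq sg l | l <- enum 'I_n]`_l)) //.
    by apply: eq_bigr => l _; rewrite sgE.
  move/eqP; rewrite psumr_eq0; last by move=> l _; rewrite subr_ge0 tge.
  move=> /allP h ij; have := h i (mem_index_enum i); rewrite /= subr_eq0 => /eqP <-.
  by congr sg; apply/val_inj.
exists (g' \o t); split=> //=.
- by move=> i j; rewrite g'o (inj_eq enum_val_inj) (inj_eq (@cast_ord_inj _ _ _)).
- by move=> i j ij; rewrite g'P (teq i j).
- by move: TX; rewrite sumT.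
Qed.

Lemma kyfan_unitary n k (M W Z : 'M[C]_n) : (k <= n)%N ->
  W \is unitarymx -> Z \is unitarymx -> kyfan k (W *m M *m Z) = kyfan k M.
Proof.
move=> kn uW uZ.
have [|V [e [b e0 en]]] := @psd_eigenbasis _ _ (adjmx M *m M).
  split; first by rewrite adjmxM adjmxK.
  by move=> x; rewrite -mulmxA -ip_mul ip_ge0.
have [uV _] := b.
have dd i : sqrtC (e i) ^+ 2 = e i by rewrite sqrtCK.
have d0 i : 0 <= sqrtC (e i) by rewrite sqrtC_ge0.
have dn : nonincreasing (fun i => sqrtC (e i)).
  by move=> i j /en; rewrite ler_sqrtC // nnegrE.
have bM : eigenbasis (adjmx M *m M) V (fun i => sqrtC (e i) ^+ 2).
  by apply: eigenbasis_of_col => // i; rewrite dd; apply: eigenbasis_col.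
have uZ' : adjmx Z \is unitarymx by rewrite trmxC_unitary.
have bW : eigenbasis (adjmx (W *m M *m Z) *m (W *m M *m Z)) (adjmx Z *m V)
    (fun i => sqrtC (e i) ^+ 2).
  split; first exact: mul_unitarymx.
  rewrite !adjmxM -!mulmxA (mulmxA Z) unitary_mulmx_adj // mul1mx.
  rewrite (mulmxA (adjmx W)) unitary_adjmx // mul1mx; congr (_ *m _).
  by rewrite mulmxA; case: bM.
rewrite (kyfan_sum kn (fun i => nth_svals i bW d0 dn)).
by rewrite (kyfan_sum kn (fun i => nth_svals i bM d0 dn)).
Qed.

Lemma frame_of_bj_orth n k (A B U P : 'M[C]_n) : (1 <= k <= n)%N ->
    U \is unitarymx -> psdmx P -> P *m P = adjmx A *m A -> A = U *m P ->
    0 < (svals A)`_k.-1 -> bj_orth (fun M : 'M[C]_n => kyfan k M) A B ->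
  exists u : 'I_k -> 'cV[C]_n,
    [/\ orthonormal_fam u, forall i : 'I_k, P *m u i = (svals A)`_i *: u i &
        \sum_(i < k) ip (u i) (adjmx U *m B *m u i) = 0].
Proof.
move=> /andP[k0 kn] uU Ppsd PP AUP sk orth.
have [V [sg [b sg0 sgn]]] := psd_eigenbasis Ppsd; have [uV _] := b.
have bA : eigenbasis (adjmx A *m A) V (fun i => sg i ^+ 2).
  apply: eigenbasis_of_col => // i.
  by rewrite -PP -mulmxA !(eigenbasis_col _ b, =^~ scalemxAr) scalerA.
have svA (i : 'I_n) : (svals A)`_i = sg i by exact: nth_svals bA sg0 sgn.
have lk : (k.-1 < n)%N by rewrite prednK.
set s := (svals A)`_k.-1 in sk; have sE : s = sg (Ordinal lk) by rewrite -svA.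
pose X := adjmx V *m (adjmx U *m B) *m V.
have sgk (i : 'I_n) : (i < k)%N -> s <= sg i.
  by move=> ik; rewrite sE; apply: sgn => /=; rewrite -ltnS prednK.
have sgnk (i : 'I_n) : (k <= i)%N -> sg i <= s.
  by move=> ik; rewrite sE; apply: sgn; apply: leq_trans (leq_pred _) ik.
have uVa : adjmx V \is unitarymx by rewrite trmxC_unitary.
have VV := unitary_mulmx_adj uV.
have crit lam : \sum_(i < n | (i < k)%N) sg i <= kyfan k (diag_mx (\row_i sg i) + lam *: X).
  rewrite -(kyfan_sum kn svA); apply: le_trans (orth lam) _.
  rewrite -[leRHS](kyfan_unitary _ kn (mul_unitarymx uU uV) uVa).
  suff -> : U *m V *m (diag_mx (\row_i sg i) + lam *: X) *m adjmx V = A + lam *: B by [].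
  rewrite mulmxDr mulmxDl AUP; congr (_ + _).
    by rewrite -!mulmxA; congr (_ *m _); rewrite mulmxA -(eigenbasisE b).
  rewrite -scalemxAr -scalemxAl /X -!mulmxA VV mulmx1 (mulmxA V) VV mul1mx.
  by rewrite mulmxA unitary_mulmx_adj // mul1mx.
have [D [Dk Dlo Dhi XD]] := critical_density kn sg0 sk sgk sgnk crit.
have [u [uo uP uX]] :=
  frame_of_density kn sgn sg0 (gtr0_real sk) sgk sgnk Dk Dlo Dhi XD.
exists (fun i => V *m u i); split.
- by move=> i j; rewrite unitary_ip.
- move=> i; have ni := leq_trans (ltn_ord i) kn.
  rewrite (svA (Ordinal ni)) (eigenbasisE b) -!mulmxA (mulmxA (adjmx V)) unitary_adjmx //.
  by rewrite mul1mx (uP i (Ordinal ni)) // -scalemxAr.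
- rewrite -[RHS]uX; apply: eq_bigr => i _.
  by rewrite ip_mul /X !mulmxA.
Qed.
End Frames.

(* Absolute value |A| is given as P: the PSD matrix with P^2 = A^* A
   (the unique PSD square root); A = U P with U unitary. *)
Theorem theorem1p1 (C : numClosedFieldType) (n k : nat)
  (A B U P : 'M[C]_n) :
  (1 <= k <= n)%N ->
  U \is unitarymx ->
  psdmx P -> P *m P = adjmx A *m A ->
  A = U *m P ->
  ((exists u : 'I_k -> 'cV[C]_n,
      [/\ orthonormal_fam u,
          (forall i : 'I_k, P *m u i = (svals A)`_i *: u i) &
          \sum_(i < k) ip (u i) (adjmx U *m B *m u i) = 0]) ->
    bj_orth (fun M : 'M[C]_n => kyfan k M) A B)
  /\
  (0 < (svals A)`_k.-1 ->
   bj_orth (fun M : 'M[C]_n => kyfan k M) A B ->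
   exists u : 'I_k -> 'cV[C]_n,
      [/\ orthonormal_fam u,
          (forall i : 'I_k, P *m u i = (svals A)`_i *: u i) &
          \sum_(i < k) ip (u i) (adjmx U *m B *m u i) = 0]).
Proof.
move=> kn uU Ppsd PP AUP; split; first by case=> u [uo uP uB]; exact: bj_orth_of_frame kn uU AUP uo uP uB.
exact: frame_of_bj_orth.
Qed.
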